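(* Let $F$ be a fullerene graph different from $F_{20}$ and $F_{24}$. If $F$ contains $R_5$ or $R_6$ as a subgraph, then $F$ is not 2-resonant.
   Context: A fullerene graph is a 3-connected plane cubic graph with exactly 12 pentagonal faces and all other faces hexagonal. $F_{20}$ is the dodecahedron. $F_{24}$ is the (unique) fullerene graph on 24 vertices: it has two hexagonal faces, each surrounded by a ring of six pentagons. $R_5$ is the graph obtained from $F_{20}$ by deleting the vertices of one pentagonal face (a central pentagon together with the five pentagons adjacent to it). $R_6$ is the graph obtained from $F_{24}$ by deleting the vertices of one hexagonal face (a central hexagon together with the ring of six pentagons around it). A set $\mathcal H$ of pairwise vertex-disjoint hexagonal faces is a resonant pattern if the graph has a perfect matching $M$ such that every hexagon in $\mathcal H$ is $M$-alternating (edges alternately in and off $M$). A fullerene graph is $k$-resonant if every set of $i$ pairwise disjoint hexagons, for each $0\le i\le k$, is a resonant pattern. *)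

(* Defs.v *)
From mathcomp Require Import all_boot all_fingroup.

Set Implicit Arguments.
Unset Strict Implicit.
Unset Printing Implicit Defensive.

Record sgraph := SGraph {
  vertex :> finType;
  adj : rel vertex;
  adj_sym : symmetric adj;
  adj_irr : irreflexive adj }.

Section Graphs.
Variable G : sgraph.

Definition nbrs (x : G) : {set G} := [set y | adj x y].

Definition edges : {set {set G}} :=
  [set [set d.1; d.2] | d : G * G & adj d.1 d.2].

Definition cubic : Prop := forall x : G, #|nbrs x| = 3.

Definition adj_avoiding (S : {set G}) : rel G :=
  fun x y => [&& adj x y, x \notin S & y \notin S].

Definition connected_avoiding (S : {set G}) : Prop :=
  forall x y : G, x \notin S -> y \notin S -> connect (adj_avoiding S) x y.

Definition connected_graph : Prop := connected_avoiding set0.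

Definition k_connected (k : nat) : Prop :=
  k < #|G| /\ forall S : {set G}, #|S| < k -> connected_avoiding S.

Definition perfect_matching (M : {set {set G}}) : Prop :=
  M \subset edges /\ forall x : G, #|[set e in M | x \in e]| = 1.

Variable S : {set G}.

Definition del_adj : rel {x : G | x \notin S} :=
  fun x y => adj (val x) (val y).

Lemma del_adj_sym : symmetric del_adj.
Proof. by move=> x y; apply: adj_sym. Qed.

Lemma del_adj_irr : irreflexive del_adj.
Proof. by move=> x; apply: adj_irr. Qed.

Definition del_vertices : sgraph := SGraph del_adj_sym del_adj_irr.

End Graphs.

Definition graph_iso (G H : sgraph) : Prop :=
  exists f : G -> H, bijective f /\ forall x y, adj (f x) (f y) = adj x y.

Definition contains_subgraph (G H : sgraph) : Prop :=
  exists f : H -> G, injective f /\ forall x y, adj x y -> adj (f x) (f y).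

(* A plane graph is represented by a rotation system: [rot x] permutes the
   neighbours of [x] in their cyclic order around [x].  A dart is an ordered
   pair of adjacent vertices, and [face_next] is the dart that follows a given
   one along the boundary of the face lying on a fixed side of it, so that the
   faces (the unbounded one included) are the orbits of [face_next] on darts. *)
Section Rotation.
Variables (G : sgraph) (rot : G -> {perm G}).

Definition face_next (d : G * G) : G * G := (d.2, rot d.2 d.1).

Definition face_of (d : G * G) : {set G * G} := [set d' | fconnect face_next d d'].

Definition rot_faces : {set {set G * G}} :=
  [set face_of d | d : G * G & adj d.1 d.2].

End Rotation.

(* A rotation system of a connected graph is an embedding in a closed oriented
   surface; Euler's formula says that this surface is the sphere. *)
Record plane_graph := PlaneGraph {
  pgraph :> sgraph;
  rot : pgraph -> {perm pgraph};
  rot_nbrs : forall x y : pgraph, adj x y -> porbit (rot x) y = nbrs x;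
  pgraph_connected : connected_graph pgraph;
  euler_formula : #|pgraph| + #|rot_faces rot| = #|edges pgraph| + 2 }.

Section Faces.
Variable F : plane_graph.

Definition faces : {set {set F * F}} := rot_faces (@rot F).

(* The length of a face is its number of darts. *)
Definition pentagons : {set {set F * F}} := [set f in faces | #|f| == 5].

Definition hexagons : {set {set F * F}} := [set f in faces | #|f| == 6].

Definition face_vertices (f : {set F * F}) : {set F} := [set d.1 | d in f].

Definition fullerene : Prop :=
  [/\ k_connected F 3, cubic F, #|pentagons| = 12
    & faces = pentagons :|: hexagons].

Definition pairwise_disjoint (H : {set {set F * F}}) : Prop :=
  forall f g, f \in H -> g \in H -> f != g ->
    [disjoint face_vertices f & face_vertices g].

Definition alternating (M : {set {set F}}) (f : {set F * F}) : Prop :=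
  forall d, d \in f ->
    ([set d.1; d.2] \in M) =
    ([set (face_next (@rot F) d).1; (face_next (@rot F) d).2] \notin M).

Definition resonant_pattern (H : {set {set F * F}}) : Prop :=
  exists M : {set {set F}},
    perfect_matching M /\ forall f, f \in H -> alternating M f.

Definition k_resonant (k : nat) : Prop :=
  forall H : {set {set F * F}}, H \subset hexagons -> pairwise_disjoint H ->
    #|H| <= k -> resonant_pattern H.

End Faces.

(* [barrel n] has two n-gonal faces, the cycles (0,i) and (3,i), each
   surrounded by n pentagons; indices i are cyclic modulo n.  The pentagons are
     (0,i) (0,i+1) (1,i+1) (2,i) (1,i)  and  (3,i) (3,i+1) (2,i+1) (1,i+1) (2,i).
   It is the dodecahedron for n = 5. *)
Section Barrel.
Variable n : nat.

Definition barrel_arc : rel ('I_4 * 'I_n) := fun x y =>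
  [|| [&& x.1 == y.1, (x.1 == 0 :> nat) || (x.1 == 3 :> nat) & y.2 == ordS x.2],
      (y.1 == x.1.+1 :> nat) && (y.2 == x.2)
    | [&& x.1 == 1 :> nat, y.1 == 2 :> nat & x.2 == ordS y.2]].

Definition barrel_adj : rel ('I_4 * 'I_n) :=
  fun x y => (x != y) && (barrel_arc x y || barrel_arc y x).

Lemma barrel_adj_sym : symmetric barrel_adj.
Proof. by move=> x y; rewrite /barrel_adj eq_sym orbC. Qed.

Lemma barrel_adj_irr : irreflexive barrel_adj.
Proof. by move=> x; rewrite /barrel_adj eqxx. Qed.

Definition barrel : sgraph := SGraph barrel_adj_sym barrel_adj_irr.

Definition barrel_end : {set barrel} := [set x : 'I_4 * 'I_n | x.1 == 3 :> nat].

End Barrel.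

Definition F20 : sgraph := barrel 5.
Definition F24 : sgraph := barrel 6.

Definition R5 : sgraph := del_vertices (barrel_end 5).
Definition R6 : sgraph := del_vertices (barrel_end 6).

(* Main.v *)
Require Import Defs.
From mathcomp Require Import all_boot all_fingroup.
From mathcomp Require Import all_algebra zify.

Set Implicit Arguments.
Unset Strict Implicit.
Unset Printing Implicit Defensive.

(* Label the cap [a_i], [b_i], [c_i] (central cycle, spokes, rim).  Its pentagons
   are nonseparating cycles, hence faces, so the rotation at the [a_i] and [b_i]
   is determined, and the faces outside the cap are the cycles
   [c_(i+1) b_(i+1) c_i u_i (w_i) u_(i+1)], with [u_i] the outer neighbour of [c_i].
   For n = 6, such a hexagon together with the central one leaves five vertices
   [b_j] whose only free neighbours are four vertices [c_j].  For n = 5, the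
   hexagons of indices i and i + 2 are disjoint and no perfect matching
   alternates on both, by forced choices; so all the outer hexagons are among two
   consecutive ones, and one or two of them would leave a cut of at most two
   vertices or a triangular face.  Without outer hexagons, F is the barrel. *)

(** Faces are mere orbits of [face_next] and planarity enters only as Euler's formula, so no Jordan
    curve theorem says that a nonseparating cycle bounds a face. Linear algebra over F_2 replaces
    it: the face boundaries span the cycle space, so a cycle is the border of a two-colouring of the
    faces, and the edges leaving a nonseparating cycle all see the same colour. A second obstacle is
    that subgraph containment is not induced and says nothing about the vertices beyond the rim:
    some [u i] might coincide or fall back into the cap, and so might the [x i]. The rotations turn
    such a coincidence into a contradiction at once, or into a similar one at smaller distance. Only
    then can hexagons be shown disjoint and exits from the cap be counted. For n = 5, indices modulo
    5 with no two at cyclic distance two are at most two, and consecutive; hence the cap has at most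
    two exits [x k], few enough for 3-connectivity to apply. *)

(** * Face boundaries generate the cycle space over F_2 *)

Section CycleSpace.
Variable F : plane_graph.
Implicit Types (x y : F) (d : F * F) (e : {set F}).
Local Notation fn := (face_next (@Defs.rot F)).

Lemma adj_rot x y : adj x (Defs.rot x y) = adj x y.
Proof.
have side (z t : F) : t \in porbit (Defs.rot x) z -> adj x z -> adj x t.
  by move=> zt xz; move: zt; rewrite (rot_nbrs xz) inE.
by apply/idP/idP; apply: side; have := mem_porbit (Defs.rot x) 1 y; rewrite expg1 // porbit_sym.
Qed.

Lemma adj_face_next d : adj (fn d).1 (fn d).2 = adj d.1 d.2.
Proof. by rewrite /= adj_rot adj_sym. Qed.

Lemma face_next_inj : injective fn.
Proof. by move=> [x y] [x2 y2] [<-] /perm_inj ->. Qed.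

Lemma face_of_next d : face_of (@Defs.rot F) (fn d) = face_of (@Defs.rot F) d.
Proof. by apply/setP=> d'; rewrite !inE -same_fconnect1 //; apply: face_next_inj. Qed.

Lemma mem_faces d : adj d.1 d.2 -> face_of (@Defs.rot F) d \in rot_faces (@Defs.rot F).
Proof. by move=> ad; apply: imset_f; rewrite inE. Qed.

Lemma mem_edges x y : adj x y -> [set x; y] \in edges F.
Proof. by move=> xy; apply/imsetP; exists (x, y); rewrite ?inE. Qed.

Lemma set2_eq x y x' y' :
  ([set x; y] == [set x'; y']) = ((x, y) == (x', y')) || ((x, y) == (y', x')).
Proof.
rewrite !xpair_eqE; apply/eqP/idP=> [E|/orP[]/andP[/eqP-> /eqP->] //]; last first.
  by rewrite setUC.
have: [&& x \in [set x'; y'], y \in [set x'; y'], x' \in [set x; y] & y' \in [set x; y]].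
  by rewrite -E set21 set22 E set21 set22.
rewrite !inE [x' == x]eq_sym [x' == y]eq_sym [y' == x]eq_sym [y' == y]eq_sym.
by do 4!case: (_ == _).
Qed.

Local Open Scope ring_scope.
Import GRing.Theory.

Local Notation nV := #|F|.
Local Notation nE := #|edges F|.
Local Notation nN := #|rot_faces (@Defs.rot F)|.
Let K : fieldType := 'F_2.

Let A : 'M[K]_(nV, nE) := \matrix_(i < nV, j < nE) (enum_val i \in enum_val j)%:R.
(** An entry counts modulo 2 the darts of the edge on the face, so an edge run twice by the same
    face contributes 0 to its boundary. *)
Let B : 'M[K]_(nN, nE) :=
  \matrix_(k < nN, j < nE) \sum_(d : F * F | adj d.1 d.2 && ([set d.1; d.2] == enum_val j))
     (face_of (@Defs.rot F) d == enum_val k)%:R.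

Let K2 (t : K) : t + t = 0.
Proof. by case: t => [[|[|]]] // ?; apply/val_inj. Qed.

Let sum_edge (G : F * F -> K) x y : adj x y ->
  \sum_(d : F * F | adj d.1 d.2 && ([set d.1; d.2] == [set x; y])) G d = G (x, y) + G (y, x).
Proof.
move=> xy; have nxy : x != y by apply: contraTneq xy => ->; rewrite adj_irr.
rewrite (bigD1 (x, y)) /=; last by rewrite xy eqxx.
rewrite (bigD1 (y, x)) /=; last first.
  by rewrite adj_sym xy setUC eqxx xpair_eqE (negbTE nxy) andbF.
rewrite big1 ?addr0 // => -[x' y'] /= /andP[/andP[/andP[_]]].
by rewrite set2_eq => /orP[]->.
Qed.

Let sum_darts (G : F * F -> K) :
  \sum_(j < nE) \sum_(d : F * F | adj d.1 d.2 && ([set d.1; d.2] == enum_val j)) G d =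
  \sum_(d : F * F | adj d.1 d.2) G d.
Proof.
under eq_bigr => j _ do rewrite big_mkcondr /=.
rewrite exchange_big /=; apply: eq_bigr => -[x y] /= xy.
rewrite (bigD1 (enum_rank_in (mem_edges xy) [set x; y])) //= big1 => [|j].
  by rewrite enum_rankK_in ?mem_edges // eqxx addr0.
rewrite -(inj_eq enum_val_inj) enum_rankK_in ?mem_edges // eq_sym.
by move/negbTE->.
Qed.

Let cf (c : 'rV[K]_nN) (d : F * F) : K :=
  \sum_(k < nN) c 0 k * (face_of (@Defs.rot F) d == enum_val k)%:R.

Let cfE c k d : face_of (@Defs.rot F) d = enum_val k -> cf c d = c 0 k.
Proof.
move=> E; rewrite /cf (bigD1 k) //= E eqxx mulr1 big1 ?addr0 // => k' kk'.
by rewrite (inj_eq enum_val_inj) eq_sym (negbTE kk') mulr0.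
Qed.

Let cf_next c d : cf c (fn d) = cf c d.
Proof. by rewrite /cf face_of_next. Qed.

Let cB c x y (xy : adj x y) :
  (c *m B) 0 (enum_rank_in (mem_edges xy) [set x; y]) = cf c (x, y) + cf c (y, x).
Proof.
rewrite mxE -sum_edge //.
under eq_bigr => k _ do rewrite mxE enum_rankK_in ?mem_edges // mulr_sumr.
by rewrite exchange_big.
Qed.

Let vA (v : 'rV[K]_nV) x y (xy : adj x y) :
  (v *m A) 0 (enum_rank_in (mem_edges xy) [set x; y]) =
    v 0 (enum_rank x) + v 0 (enum_rank y).
Proof.
have nxy : x != y by apply: contraTneq xy => ->; rewrite adj_irr.
rewrite mxE (bigD1 (enum_rank x)) // (bigD1 (enum_rank y)) /=; last first.
  by rewrite (inj_eq enum_rank_inj) eq_sym.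
rewrite !mxE !enum_rankK_in ?mem_edges // ?set21 ?set22 ?mulr1.
rewrite big1 ?addr0 // => i /andP[ix iy].
rewrite mxE enum_rankK_in ?mem_edges // !inE.
rewrite -{1}(enum_valK i) (inj_eq enum_rank_inj) in ix.
rewrite -{1}(enum_valK i) (inj_eq enum_rank_inj) in iy.
by rewrite (negbTE ix) (negbTE iy) mulr0.
Qed.

Let addK0 (s t : K) : s + t = 0 -> s = t.
Proof. by move=> st; rewrite -[LHS]addr0 -(K2 t) addrA st add0r. Qed.

(** The left kernel lies in the line spanned by the all-ones row. *)
Let const_rank m n (X : 'M[K]_(m, n)) :
  (forall v : 'rV_m, v *m X = 0 -> forall i j, v 0 i = v 0 j) -> (m - 1 <= \rank X)%N.
Proof.
move=> cst; rewrite leq_subCl -mxrank_ker.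
suff le : (kermx X <= (const_mx 1 : 'rV[K]_m))%MS by rewrite (leq_trans (mxrankS le)) ?rank_leq_row.
apply/row_subP=> i; set v := row i _.
have v0 : v *m X = 0 by rewrite /v -row_mul mulmx_ker row0.
suff -> : v = v 0 i *: const_mx 1 by apply: scalemx_sub.
by clearbody v; apply/matrixP=> i0 j; rewrite ord1 (cst _ v0 j i) !mxE mulr1.
Qed.

Let connE (T : Type) (h : F -> T) :
  (forall x y, adj x y -> h x = h y) -> forall x y, h x = h y.
Proof.
move=> hadj x y.
have /connectP[p] : connect (adj_avoiding set0) x y.
  by apply: pgraph_connected; rewrite inE.
elim: p x => [|z p IHp] x /= => [_ -> //|/andP[/andP[xz _] zp] yE].
by rewrite (hadj _ _ xz); apply: IHp.
Qed.

Let rankA : (nV - 1 <= \rank A)%N.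
Proof.
apply: const_rank => v v0 i j.
rewrite -(enum_valK i) -(enum_valK j).
apply: (connE (h := fun x => v 0 (enum_rank x))) => x y xy.
by apply: addK0; rewrite -(vA v xy) v0 mxE.
Qed.

Let const_orbit (T : Type) (h : F -> T) x : (forall y, adj x y -> h (Defs.rot x y) = h y) ->
  forall y z, adj x y -> adj x z -> h y = h z.
Proof.
move=> hr y z xy xz.
have : z \in porbit (Defs.rot x) y by rewrite (rot_nbrs xy) inE.
case/porbitP=> k -> {z xz}.
elim: k => [|k IHk]; first by rewrite perm1.
rewrite expgSr permM hr //.
elim: k {IHk} => [|k IHk]; first by rewrite perm1.
by rewrite expgSr permM adj_rot.
Qed.

(** A face colouring killed by [B] agrees across every edge. Turning around a vertex crosses all the
    faces there, and connectedness of the graph carries the common colour from vertex to vertex. *)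
Let rankB : (nN - 1 <= \rank B)%N.
Proof.
apply: const_rank => c c0.
have cfs x y : adj x y -> cf c (x, y) = cf c (y, x).
  by move=> xy; apply: addK0; rewrite -(cB c xy) c0 mxE.
(* The colour shared by all darts leaving [x]; an option, because a neighbour of [x] has to be
   picked. *)
pose h x := omap (fun y => cf c (x, y)) [pick y | adj x y].
have hE x y : adj x y -> h x = Some (cf c (x, y)).
  rewrite /h; case: pickP => [z xz xy|->//]; congr Some.
  apply: (const_orbit (h := fun y => cf c (x, y))) xz xy => t xt.
  by rewrite (cfs x t xt) -(cf_next _ (t, x)).
have hC : forall x y, h x = h y.
  apply: connE => x y xy; rewrite (hE x y xy) (hE y x) ?(cfs x y xy) //.
  by rewrite adj_sym.
move=> i j.
have /imsetP[[x y] /= xy iE] := enum_valP i.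
have /imsetP[[x' y'] /= xy' jE] := enum_valP j.
rewrite -(cfE c (esym iE)) -(cfE c (esym jE)).
rewrite !inE in xy xy'; apply: Some_inj; rewrite -(hE x y xy) -(hE x' y' xy'); exact: hC.
Qed.

(** [face_next] sends the darts of a face that end at [x] bijectively to those that start at [x];
    the two counts agree and cancel in characteristic 2. *)
Let BA : B *m A^T = 0.
Proof.
apply/matrixP=> k i; rewrite !mxE; set x := enum_val i.
pose G (z : F * F) : K := (face_of (@Defs.rot F) z == enum_val k)%:R.
pose S1 := \sum_(d : F * F | adj d.1 d.2) G d * (d.1 == x)%:R.
pose S2 := \sum_(d : F * F | adj d.1 d.2) G d * (d.2 == x)%:R.
have SE : S1 = S2.
  rewrite /S1 (reindex_inj face_next_inj) /=; apply: eq_big => d.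
    exact: adj_face_next.
  by move=> _; rewrite /G face_of_next.
transitivity (S1 + S2); last by rewrite SE K2.
rewrite /S1 /S2 -big_split /=.
rewrite -(sum_darts (fun d => G d * (d.1 == x)%:R + G d * (d.2 == x)%:R)).
apply: eq_bigr => j _; rewrite !mxE mulr_suml; apply: eq_bigr => -[y z] /= /andP[yz /eqP<-].
have nyz : y != z by apply: contraTneq yz => ->; rewrite adj_irr.
rewrite -mulrDr; congr (_ * _).
rewrite !inE -natrD ![x == _]eq_sym; case: eqP => [<-|] //=.
by rewrite eq_sym (negbTE nyz).
Qed.

(* Over [F_2] the face boundaries are orthogonal to the vertex stars, and by
   Euler's formula the two ranks add up to the number of edges; so every even
   set of edges is a sum of face boundaries. *)
Lemma even_edge_set_bounds (z : rel F) :
    symmetric z -> subrel z (@adj F) -> (forall x, ~~ odd #|[set y | z x y]|) ->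
  exists c : F * F -> bool,
    (forall d, c (fn d) = c d) /\
    forall x y, adj x y -> c (x, y) (+) c (y, x) = z x y.
Proof.
move=> zsym zadj zeven.
pose w : 'rV[K]_nE :=
  \row_(j < nE) [exists d, (enum_val j == [set d.1; d.2]) && z d.1 d.2]%:R.
have wE x y (xy : adj x y) : w 0 (enum_rank_in (mem_edges xy) [set x; y]) = (z x y)%:R.
  rewrite mxE enum_rankK_in ?mem_edges //; congr (nat_of_bool _)%:R.
  apply/existsP/idP => [[[x' y'] /= /andP[]]|zxy]; last by exists (x, y); rewrite eqxx.
  by rewrite set2_eq => /orP[]/eqP[-> ->] //; rewrite zsym.
have wA : w *m A^T = 0.
  apply/matrixP=> i0 i; rewrite ord1 !mxE; set x := enum_val i.
  transitivity ((#|[set y | z x y]|)%:R : K); last first.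
    rewrite -(odd_double_half #|_|) (negbTE (zeven x)) add0n -addnn natrD; exact: K2.
  transitivity (\sum_(d : F * F | adj d.1 d.2) (d.1 == x)%:R * (z d.1 d.2)%:R : K).
    rewrite -sum_darts; apply: eq_bigr => j _.
    have /imsetP[[p q] pq eE] := enum_valP j; rewrite inE /= in pq eE.
    have npq : p != q by apply: contraTneq pq => ->; rewrite adj_irr.
    have -> : w 0 j = (z p q)%:R
      by rewrite -wE; congr (w 0 _); apply: enum_val_inj; rewrite enum_rankK_in ?mem_edges.
    rewrite eE sum_edge //= [z q p]zsym -mulrDl mulrC !mxE -/x eE !inE -natrD ![x == _]eq_sym.
    by case: eqP => [<-|] //=; rewrite eq_sym (negbTE npq).
  rewrite -sum1_card natr_sum big_mkcond [RHS]big_mkcond /=.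
  rewrite -(pair_bigA _ (fun p q => if adj p q then (p == x)%:R * (z p q)%:R else 0)) /=.
  rewrite (bigD1 x) //= [X in _ + X]big1 => [|p /negbTE->]; last first.
    by rewrite big1 // => q _; rewrite mul0r if_same.
  rewrite addr0; apply: eq_bigr => q _; rewrite inE eqxx mul1r.
  by case: ifP => xq; case: ifP => // zxq; rewrite (zadj _ _ zxq) in xq.
have le : (B <= kermx A^T)%MS by rewrite sub_kermx BA.
have [_ /esym eqr] := mxrank_leqif_sup le.
have le' : (kermx A^T <= B)%MS.
  rewrite eqr eqn_leq mxrankS //= mxrank_ker mxrank_tr.
  have eul := euler_formula F.
  have arith (v n e a b : nat) :
      (v + n = e + 2 -> v - 1 <= a -> n - 1 <= b -> e - a <= b)%N by lia.
  exact: arith eul rankA rankB.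
have /submxP[c cE] : (w <= B)%MS by rewrite (submx_trans _ le') // sub_kermx wA.
exists (fun d => cf c d != 0); split=> [d|x y xy]; first by rewrite cf_next.
have := cB c xy; rewrite -cE wE.
by move: (cf c _) (cf c _) (z x y) => [[|[|]] // ?] [[|[|]] // ?] [].
Qed.
End CycleSpace.

(** * Rotations at cubic vertices; nonseparating induced cycles are faces *)

Section Cubic.
Variable F : plane_graph.
Hypothesis F3 : cubic F.
Implicit Types (x y : F) (d : F * F).
Local Notation r := (@Defs.rot F).
Local Notation fn := (face_next r).

Record turn x y1 y2 y3 : Prop := Turn {
  turn12 : r x y1 = y2;
  turn23 : r x y2 = y3;
  turn31 : r x y3 = y1;
  turn_neq : uniq [:: x; y1; y2; y3];
  turn_adj : forall z, adj x z = (z \in [:: y1; y2; y3]) }.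

Lemma adj_neq (G : sgraph) (x y : G) : adj x y -> x != y.
Proof. by apply: contraTneq => ->; rewrite adj_irr. Qed.

Lemma turnP x y1 y2 : adj x y1 -> r x y1 = y2 -> turn x y1 y2 (r x y2).
Proof.
move=> xy <-.
have o3 : #|porbit (r x) y1| = 3 by rewrite (rot_nbrs xy) F3.
have := iter_porbit (r x) y1; rewrite o3 /= => r3.
have := uniq_traject_porbit (r x) y1; rewrite o3 /= => u3.
split=> // [|z].
  suff xn : x \notin [:: y1; r x y1; r x (r x y1)] by rewrite cons_uniq xn.
  by rewrite !inE !negb_or !adj_neq // ?adj_rot.
have -> : adj x z = (z \in nbrs x) by rewrite inE.
by rewrite -(rot_nbrs xy) porbit_traject o3.
Qed.

Lemma turn_shift x y1 y2 y3 : turn x y1 y2 y3 -> turn x y2 y3 y1.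
Proof.
case=> E1 E2 E3 u xA; split=> // [|z]; last first.
  by rewrite xA !inE; do 3!case: (_ == _).
by apply: etrans u; apply: perm_uniq; rewrite perm_cons (perm_rot 1 [:: y1; y2; y3]).
Qed.

Lemma turn_of_neq x y1 y2 y3 : adj x y1 -> adj x y2 -> adj x y3 ->
  uniq [:: y1; y2; y3] -> turn x y1 y2 y3 \/ turn x y3 y2 y1.
Proof.
move=> x1 x2 x3; have T := turnP x1 erefl; case: (T) => _ _ _.
move: x2 x3; rewrite !(turn_adj T) /= !inE !negb_or !andbT.
move=> /or3P[]/eqP E2 /or3P[]/eqP E3; rewrite E2 E3 ?eqxx ?andbF //.
  by move=> _; left.
by move=> _; right; apply: turn_shift.
Qed.

Lemma turn_of_rot x y1 y2 y3 : adj x y1 -> adj x y2 -> adj x y3 ->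
  uniq [:: y1; y2; y3] -> r x y1 = y2 -> turn x y1 y2 y3.
Proof.
move=> x1 x2 x3 u E; case: (turn_of_neq x1 x2 x3 u) => // T.
by move: u; rewrite -E (turn31 T) /= !inE eqxx !andbF.
Qed.

Section InducedCycle.
Variable p : seq F.
Hypotheses (p_uniq : uniq p) (p_gt2 : 2 < size p) (p_cycle : path.cycle (@adj F) p).
Hypothesis p_induced : forall x t, x \in p -> adj x t ->
  t != next p x -> t != prev p x -> t \notin p.

Let z : rel F := fun x y => (x \in p) && ((y == next p x) || (y == prev p x)).

Lemma next_neq_prev x : x \in p -> next p x != prev p x.
Proof.
move=> xp; case: (rot_to xp) => i q pE.
have := p_uniq; rewrite -(rot_uniq i) pE => u.
apply/eqP=> E; have := next_prev p_uniq x; rewrite -E.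
have: 2 < size (x :: q) by rewrite -pE size_rot.
rewrite -!(next_rot i p_uniq) pE; case: q u {pE E} => [|y [|w q]] //= u _.
move: u; rewrite eqxx !inE !negb_or => /andP[/and3P[/negbTE xy /negbTE xw _] _].
by rewrite [y == x]eq_sym xy eqxx => wx; rewrite wx eqxx in xw.
Qed.

Let cycle_edges_sym : symmetric z.
Proof.
suff side x y : z x y -> z y x by move=> x y; apply/idP/idP; apply: side.
rewrite /z => /andP[xp /orP[]/eqP->].
  by rewrite mem_next xp prev_next // eqxx orbT.
by rewrite mem_prev xp next_prev // eqxx.
Qed.

Lemma adj_next x : x \in p -> adj x (next p x).
Proof. exact: next_cycle p_cycle. Qed.

Lemma adj_prev x : x \in p -> adj x (prev p x).
Proof. by rewrite adj_sym; apply: prev_cycle p_cycle. Qed.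


Lemma cycle_edges_adj : subrel z (@adj F).
Proof. by move=> x y /andP[xp /orP[]/eqP->]; rewrite ?adj_next ?adj_prev. Qed.

Lemma cycle_edges_even x : ~~ odd #|[set y | z x y]|.
Proof.
have [xp|xp] := boolP (x \in p); last first.
  by rewrite (_ : [set y | z x y] = set0) ?cards0 //; apply/setP=> y; rewrite !inE /z (negbTE xp).
rewrite (_ : [set y | z x y] = [set next p x; prev p x]) ?cards2 ?next_neq_prev //.
by apply/setP=> y; rewrite !inE /z xp.
Qed.

(* An even set of edges bounds a two-colouring of the faces; off the cycle the
   colour cannot change, so if the rest of the graph is connected all the edges
   leaving the cycle lie on the same side of it. *)
Lemma nonseparating_cycle_face :
    (forall x y s t, x \in p -> y \in p -> adj x s -> adj y t ->
       s \notin p -> t \notin p -> connect (adj_avoiding [set v in p]) s t) ->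
  (forall x, x \in p -> r x (prev p x) = next p x) \/
  (forall x, x \in p -> r x (next p x) = prev p x).
Proof.
move=> conn.
have [c [c_next cE]] := even_edge_set_bounds cycle_edges_sym cycle_edges_adj cycle_edges_even.
have c_rot x y : c (x, r x y) = c (y, x) by rewrite -(c_next (y, x)).
have off x y : x \notin p -> adj x y -> c (x, y) = c (y, x).
  move=> xp xy; apply/eqP; rewrite -negb_add cE //.
  by rewrite /z (negbTE xp).
have offC x y y' : x \notin p -> adj x y -> adj x y' -> c (x, y) = c (x, y').
  move=> xp xy; have T := turnP xy erefl.
  have rxy : adj x (r x y) by rewrite adj_rot.
  rewrite (turn_adj T) !inE => /or3P[]/eqP-> //; first by rewrite c_rot off.
  by rewrite c_rot -(off x (r x y)) // c_rot off.
have conC s t s' t' : connect (adj_avoiding [set v in p]) s t ->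
    s \notin p -> t \notin p -> adj s s' -> adj t t' -> c (s, s') = c (t, t').
  case/connectP=> q; elim: q s s' => [|w q IHq] s s' /=.
    by move=> _ -> sp _; apply: offC.
  case/andP=> /and3P[sw _]; rewrite inE => wp qP tE sp tp ss' tt'.
  rewrite (offC s s' w) // off // -(IHq w s) //; last by rewrite adj_sym.
(* Either both darts follow each other on one face, or the third edge at [x] comes between them, and
   the colour does not change across an edge off the cycle. *)
have cyc x : x \in p -> c (prev p x, x) = c (x, next p x).
  move=> xp; have [xn xq] := (adj_next xp, adj_prev xp).
  have xnq := next_neq_prev xp.
  have T := turnP xn erefl; move: xq xnq (T); rewrite (turn_adj T) !inE => /or3P[]/eqP E.
  - by rewrite E eqxx.
  - rewrite -E => _ T'.
    have xt : adj x (r x (prev p x)) by rewrite adj_rot adj_prev.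
    have tp : r x (prev p x) \notin p.
      apply: (p_induced xp xt); have := turn_neq T'; rewrite /= !inE !negb_or.
        by case/and4P=> _ /andP[_]; rewrite eq_sym.
      by case/and4P=> _ _; rewrite eq_sym ?andbT.
    by rewrite -(c_rot x (prev p x)) -(off _ x tp) ?[adj _ x]adj_sym // -c_rot (turn31 T').
  - by move=> _ T'; rewrite E -c_rot (turn31 T').
have cst x y : x \in p -> y \in p -> c (x, next p x) = c (y, next p y).
  move=> xp; rewrite -(fconnect_cycle (cycle_next p_uniq) xp) => /iter_findex <-.
  elim: (findex _ _ _) => [//|k IHk] /=; rewrite IHk -{1}(prev_next p_uniq (iter k (next p) x)).
  rewrite cyc ?prev_next // mem_next.
  by elim: k {IHk} => [|k IHk] //=; rewrite mem_next.
(* If a face takes the corner from [prev p x] to [next p x], the third edge lies on the other side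
   of the cycle and has the opposite colour; otherwise it has the colour of [(x, next p x)]. The
   colour of the third edge thus reveals the rotation. *)
have side x : x \in p -> exists t, [/\ adj x t, t \notin p &
    (r x (prev p x) = next p x /\ c (t, x) = ~~ c (x, next p x)) \/
    (r x (next p x) = prev p x /\ c (t, x) = c (x, next p x))].
  move=> xp; have [xn xq] := (adj_next xp, adj_prev xp).
  have xnq := next_neq_prev xp.
  have T := turnP xn erefl; move: xq xnq (T); rewrite (turn_adj T) !inE => /or3P[]/eqP E.
  - by rewrite E eqxx.
  - rewrite -E => _ T'; exists (r x (prev p x)); split.
    + by rewrite adj_rot adj_prev.
    + have xt : adj x (r x (prev p x)) by rewrite adj_rot adj_prev.
      apply: (p_induced xp xt); have := turn_neq T'; rewrite /= !inE !negb_or.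
        by case/and4P=> _ /andP[_]; rewrite eq_sym.
      by case/and4P=> _ _; rewrite eq_sym ?andbT.
    + by right; split=> //; rewrite -c_rot (turn31 T').
  - move=> _ T'; have xt : adj x (r x (next p x)) by rewrite adj_rot adj_next.
    have tp : r x (next p x) \notin p.
      apply: (p_induced xp xt); have := turn_neq T'; rewrite /= !inE !negb_or -?E.
        by case/and4P=> _ /andP[]; rewrite eq_sym.
      by case/and4P=> _ _.
    exists (r x (next p x)); split.
    + by rewrite adj_rot adj_next.
    + exact: tp.
    + left; split; first by rewrite E (turn31 T').
      rewrite (off _ x tp) ?[adj _ x]adj_sym // c_rot; have := cE x (next p x) xn.
      by rewrite /z xp eqxx; case: (c _); case: (c _).
have [x0 x0p] : exists x, x \in p by case: (p) p_gt2 => // x q _; exists x; rewrite inE eqxx.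
have agree x y s t : x \in p -> y \in p -> adj x s -> adj y t -> s \notin p -> t \notin p ->
    c (s, x) = c (t, y).
  move=> xp yp xs yt sp tp; apply: (conC _ _ _ _ (conn x y s t _ _ _ _ _ _)) => //.
    by rewrite adj_sym.
  by rewrite adj_sym.
have [t0 [xt0 t0p side0]] := side x0 x0p.
case: side0 => -[_ c0]; [left|right] => x xp; have [t [xt tp [[]|[]]]] := side x xp => // _.
  by rewrite (cst x x0) // (agree x x0 t t0) // c0; case: (c _).
by rewrite (cst x x0) // (agree x x0 t t0) // c0; case: (c _).
Qed.

End InducedCycle.
End Cubic.

(** * Uses of 3-connectedness and of the face lengths 5 and 6 *)

Section Fullerene.
Variable F : plane_graph.
Hypothesis F_full : fullerene F.
Implicit Types (x y : F) (d : F * F).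
Local Notation r := (@Defs.rot F).
Local Notation fn := (face_next r).

Lemma fullerene_cubic : cubic F.
Proof. by case: F_full. Qed.
Hint Resolve fullerene_cubic : core.

Lemma card_face d : #|face_of r d| = fingraph.order fn d.
Proof. by rewrite cardsE. Qed.

Lemma face_length d : adj d.1 d.2 -> fingraph.order fn d = 5 \/ fingraph.order fn d = 6.
Proof.
move=> ad; have := mem_faces ad; case: F_full => _ _ _; rewrite /faces => ->.
by rewrite !inE -card_face => /orP[]/andP[_ /eqP]; [left|right].
Qed.

(** Applied with [k = 3], to exclude triangular faces. *)
Lemma short_face d k : adj d.1 d.2 -> iter k fn d = d -> k < 5 -> k = 0.
Proof.
move=> ad kd k5; have ko : k < fingraph.order fn d by case: (face_length ad) => ->; lia.
by have := findex_iter ko; rewrite kd findex0.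
Qed.

Lemma connected_minus (T : {set F}) x y : #|T| < 3 -> x \notin T -> y \notin T ->
  connect (adj_avoiding T) x y.
Proof. by case: F_full => -[_ FT] _ _ _ T3; apply: FT. Qed.

(** The form in which 3-connectedness is exploited: [P] is a component or the cap, and [T] collects
    the possible exits from it. *)
Lemma cut_closed (T : {set F}) (P : F -> Prop) s : #|T| < 3 -> s \notin T -> P s ->
  (forall x y, P x -> adj x y -> y \notin T -> P y) ->
  forall y, y \notin T -> P y.
Proof.
move=> T3 sT Ps Pcl y yT; have /connectP[p] := connected_minus T3 sT yT.
elim: p s Ps {sT} => [s Ps _ -> //|w p IHp] s Ps /= /andP[/and3P[sw _ wT] wp].
by apply: IHp wp; apply: Pcl Ps sw wT.
Qed.

Lemma uniq_turn_nbr x y1 y2 y3 z : adj x y1 -> adj x y2 -> adj x y3 -> uniq [:: y1; y2; y3] ->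
  adj x z -> z \in [:: y1; y2; y3].
Proof.
move=> x1 x2 x3 u; case: (turn_of_neq fullerene_cubic x1 x2 x3 u) => T; rewrite (turn_adj T) //.
by rewrite !inE; do 3!case: (_ == _).
Qed.

(* Only the neighbours of [p0] off the cycle are not known to be connected to the
   rest of its complement; if they were not, [p0] would be a cut vertex. *)
Lemma pentagon_turns p0 p1 p2 p3 p4 t1 t2 t3 t4 :
    let p := [:: p0; p1; p2; p3; p4] in
    uniq p -> path.cycle (@adj F) p -> all [predC p] [:: t1; t2; t3; t4] ->
    [&& adj p1 t1, adj p2 t2, adj p3 t3 & adj p4 t4] ->
    (forall t, adj p0 t -> t \in p -> t \in [:: p1; p4]) ->
    (forall t, t \in [:: t1; t3; t4] -> connect (adj_avoiding [set v in p]) t t2) ->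
  [/\ r p0 p4 = p1, r p1 p0 = p2, r p2 p1 = p3, r p3 p2 = p4 & r p4 p3 = p0] \/
  [/\ r p0 p1 = p4, r p1 p2 = p0, r p2 p3 = p1, r p3 p4 = p2 & r p4 p0 = p3].
Proof.
move=> p; have pE : p = [:: p0; p1; p2; p3; p4] by [].
clearbody p; move=> p_uniq p_cyc t_out /and4P[pt1 pt2 pt3 pt4] p0_out t_conn.
have symT : connect_sym (adj_avoiding [set v in p]).
  by apply: sym_connect_sym => x y; rewrite /adj_avoiding adj_sym; case: (adj _ _); rewrite //= andbC.
have nextE i : i < 5 -> next p (nth p0 p i) = nth p0 p (i.+1 %% 5).
  have sp : size p = 5 by rewrite pE.
  move=> i5; rewrite next_nth mem_nth ?sp // index_uniq ?sp //.
  by rewrite {sp} pE; move: i i5; do 5!case=> //.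
have [n0 n1 n2 n3 n4] : [/\ next p p0 = p1, next p p1 = p2, next p p2 = p3,
    next p p3 = p4 & next p p4 = p0].
  by split; [have := nextE 0|have := nextE 1
    |have := nextE 2|have := nextE 3|have := nextE 4]; rewrite pE; apply.
have [q0 q1 q2 q3 q4] : [/\ prev p p0 = p4, prev p p1 = p0, prev p p2 = p1,
    prev p p3 = p2 & prev p p4 = p3].
  by split; rewrite -?n0 -?n1 -?n2 -?n3 -?n4 prev_next // ?n0 ?n1 ?n2 ?n3 ?n4.
have third q n p' t t' : adj q n -> adj q p' -> adj q t -> n \in p -> p' \in p -> t \notin p ->
    n != p' -> adj q t' -> t' \in [:: n; p'; t].
  move=> qn qp qt np p'p tp nq; apply: uniq_turn_nbr qn qp qt _.
  have neq u v : u \in p -> v \notin p -> u != v by move=> up; apply: contraNneq => <-.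
  by rewrite /= !inE negb_or nq !neq.
have nbr q : q \in p -> q != p0 -> exists2 t, t \in [:: t1; t2; t3; t4] &
    forall s, adj q s -> s \in [:: next p q; prev p q; t].
  move=> qp qn0; have qi : q \in [:: p1; p2; p3; p4] by move: qp; rewrite pE inE (negbTE qn0).
  have nd : next p q != prev p q by apply: next_neq_prev; rewrite // pE.
  have thq t : adj q t -> t \notin p -> forall s, adj q s -> s \in [:: next p q; prev p q; t].
    move=> qt tp s; apply: third => //; rewrite ?mem_next ?mem_prev //.
      exact: adj_next.
    exact: adj_prev.
  move: t_out => /= /and5P[o1 o2 o3 o4 _].
  have [t ti [qt tp]] : exists2 t, t \in [:: t1; t2; t3; t4] & adj q t /\ t \notin p.
    move: qi; rewrite !inE => /or4P[]/eqP->; [exists t1|exists t2|exists t3|exists t4];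
    by rewrite ?inE ?eqxx ?orbT.
  by exists t => //; apply: thq.
have induced q t : q \in p -> adj q t -> t != next p q -> t != prev p q -> t \notin p.
  have [-> _ p0t|qn0 qp qt tn tq] := eqVneq q p0.
    rewrite n0 q0 => t1n t4n; apply/negP=> tp.
    by have := p0_out t p0t tp; rewrite !inE (negbTE t1n) (negbTE t4n).
  have [s si snbr] := nbr q qp qn0; have := snbr t qt.
  rewrite !inE (negbTE tn) (negbTE tq) => /eqP->.
  by have /allP/(_ s si) := t_out.
have exit q t : q \in p -> q != p0 -> adj q t -> t \notin p -> t \in [:: t1; t2; t3; t4].
  move=> qp qn0 qt tp; have [s si snbr] := nbr q qp qn0; have := snbr t qt.
  rewrite !inE => /or3P[]/eqP tE; move: tp; rewrite tE ?mem_next ?mem_prev ?qp //.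
  by move: si; rewrite !inE.
have t2p : t2 \notin p by case/and5P: t_out.
have conn t : t \in [:: t1; t2; t3; t4] -> connect (adj_avoiding [set v in p]) t t2.
  have [-> _|tn2 ti] := eqVneq t t2; first exact: connect0.
  by apply: t_conn; move: ti; rewrite !inE (negbTE tn2).
have conn0 t : adj p0 t -> t \notin p -> connect (adj_avoiding [set v in p]) t t2.
  move=> p0t tp; have t2p0 : t2 \notin [set p0].
    by rewrite inE; apply: contraNneq t2p => ->; rewrite pE inE eqxx.
  have tp0 : t \notin [set p0].
    by rewrite inE; apply: contraNneq tp => ->; rewrite pE inE eqxx.
  have [//|nc] := boolP (connect (adj_avoiding [set v in p]) t t2).
  (* A component missing [t2] can touch the cycle only at [p0]: reached from any other cycle vertex,
     it would contain one of the [t_i], all of which are joined to [t2]. *)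
  pose Q v := v \notin p /\ connect (adj_avoiding [set v in p]) t v.
  suff [_ tt2] : Q t2 by rewrite tt2 in nc.
  have Q_closed x y : Q x -> adj x y -> y \notin [set p0] -> Q y.
    move=> [xp tx] xy; rewrite inE => yp0; have [yp|yp] := boolP (y \in p).
      have yx : adj y x by rewrite adj_sym.
      by case/negP: nc; apply: connect_trans tx (conn x (exit y x yp yp0 yx xp)).
    split=> //; apply: connect_trans tx (connect1 _).
    by rewrite /adj_avoiding xy !inE xp yp.
  by apply: (cut_closed _ tp0 _ Q_closed t2p0); rewrite ?cards1 //; split.
have all_conn q t : q \in p -> adj q t -> t \notin p -> connect (adj_avoiding [set v in p]) t t2.
  have [->|qn0 qp qt tp] := eqVneq q p0; first by move=> _; apply: conn0.
  exact: conn (exit q t qp qn0 qt tp).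
have p_gt2 : 2 < size p by rewrite pE.
have nonsep q q' t t' : q \in p -> q' \in p -> adj q t -> adj q' t' -> t \notin p -> t' \notin p ->
    connect (adj_avoiding [set v in p]) t t'.
  move=> qp q'p qt q't' tp t'p; apply: connect_trans (all_conn q t qp qt tp) _.
  by rewrite symT; apply: all_conn q't' t'p.
have mem_p q : q \in [:: p0; p1; p2; p3; p4] -> q \in p by rewrite pE.
case: (nonseparating_cycle_face fullerene_cubic p_uniq p_gt2 p_cyc induced nonsep) => rp; [left|right].
  split; [have := rp p0|have := rp p1|have := rp p2|have := rp p3|have := rp p4];
  by rewrite ?n0 ?n1 ?n2 ?n3 ?n4 ?q0 ?q1 ?q2 ?q3 ?q4; apply; apply: mem_p; rewrite !inE eqxx ?orbT.
split; [have := rp p0|have := rp p1|have := rp p2|have := rp p3|have := rp p4];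
by rewrite ?n0 ?n1 ?n2 ?n3 ?n4 ?q0 ?q1 ?q2 ?q3 ?q4; apply; apply: mem_p; rewrite !inE eqxx ?orbT.
Qed.
End Fullerene.

(** * Caps and their orientation *)

Section Cap.
Variables (F : plane_graph) (n : nat).
Hypothesis n56 : n = 5 \/ n = 6.
Implicit Types (x y : F) (a b c : nat -> F) (i j : nat).
Local Notation r := (@Defs.rot F).
Local Notation fn := (face_next r).

(** Labels are indexed by all naturals and coincide exactly for congruent indices, so cyclic
    arithmetic stays in [nat]. The rim vertex [c i] sits between [b i] and [b i.+1]. Further edges
    between rim vertices are not excluded. *)
Record cap a b c : Prop := Cap {
  cap_aa : forall i, adj (a i) (a i.+1);
  cap_ab : forall i, adj (a i) (b i);
  cap_bc : forall i, adj (b i) (c i);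
  cap_cb : forall i, adj (c i) (b i.+1);
  cap_aE : forall i j, (a i == a j) = (i == j %[mod n]);
  cap_bE : forall i j, (b i == b j) = (i == j %[mod n]);
  cap_cE : forall i j, (c i == c j) = (i == j %[mod n]);
  cap_a_b : forall i j, (a i == b j) = false;
  cap_a_c : forall i j, (a i == c j) = false;
  cap_b_c : forall i j, (b i == c j) = false }.

Definition shift (f : nat -> F) k i := f (i + k).

Lemma cap_shift a b c k : cap a b c -> cap (shift a k) (shift b k) (shift c k).
Proof.
case=> aa ab bc cb aE bE cE a_b a_c b_c.
by split=> [i|i|i|i|i j|i j|i j|i j|i j|i j]; rewrite /shift ?aE ?bE ?cE ?eqn_modDr.
Qed.

(** As [n.-1] is -1 modulo [n], the index is -(i + k) without subtraction. The rim takes [k = 1]: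
    the rim vertex between the spokes of indices -i and -i - 1 has index -i - 1. *)
Definition reflect_cap (f : nat -> F) k i := f (n.-1 * (i + k)).

Lemma mod_reflect i j : (n.-1 * i == n.-1 * j %[mod n]) = (i == j %[mod n]).
Proof. by case: n56 => ->; apply/eqP/eqP; lia. Qed.

Lemma cap_reflect a b c : cap a b c -> cap (reflect_cap a 0) (reflect_cap b 0) (reflect_cap c 1).
Proof.
case=> aa ab bc cb aE bE cE a_b a_c b_c.
have back i : (n.-1 * i.+1).+1 = n.-1 * i %[mod n] by case: n56 => ->; lia.
split=> [i|i|i|i|i j|i j|i j|i j|i j|i j];
  rewrite /reflect_cap ?aE ?bE ?cE ?mod_reflect ?eqn_modDr ?addn0 ?addn1 //.
- have /eqP <- : a (n.-1 * i.+1).+1 == a (n.-1 * i) by rewrite aE back.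
  by rewrite adj_sym.
- have /eqP <- : b (n.-1 * i.+1).+1 == b (n.-1 * i) by rewrite bE back.
  by rewrite adj_sym.
- by rewrite adj_sym.
Qed.

Definition pentagon_left a b c i :=
  [/\ r (c i) (b i) = b i.+1, r (b i.+1) (c i) = a i.+1, r (a i.+1) (b i.+1) = a i,
      r (a i) (a i.+1) = b i & r (b i) (a i) = c i].

Definition pentagon_right a b c i :=
  [/\ r (c i) (b i.+1) = b i, r (b i.+1) (a i.+1) = c i, r (a i.+1) (a i) = b i.+1,
      r (a i) (b i) = a i.+1 & r (b i) (c i) = a i].

Hypothesis F_full : fullerene F.
Let F3 : cubic F := fullerene_cubic F_full.

Lemma connect_avoiding_path2 (T : {set F}) x y z : x \notin T -> y \notin T -> z \notin T ->
  adj x y -> adj y z -> connect (adj_avoiding T) x z.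
Proof.
move=> xT yT zT xy yz.
by apply: (connect_trans (y := y)); apply: connect1; rewrite /adj_avoiding ?xy ?yz ?xT ?yT.
Qed.

Lemma cap_pentagon0 a b c : cap a b c -> pentagon_left a b c 0 \/ pentagon_right a b c 0.
Proof.
move=> C; have [aa ab bc cb aE bE cE a_b a_c b_c] := C.
have b_a i j : (b i == a j) = false by rewrite eq_sym a_b.
have c_a i j : (c i == a j) = false by rewrite eq_sym a_c.
have c_b i j : (c i == b j) = false by rewrite eq_sym b_c.
have sy x y : adj x y -> adj y x by rewrite adj_sym.
have dist := (aE, bE, cE, a_b, a_c, b_c, b_a, c_a, c_b).
have a0 : a n = a 0 by apply/eqP; rewrite aE modnn mod0n.
have b0 : b n = b 0 by apply/eqP; rewrite bE modnn mod0n.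
have nbr_a i x : adj (a i.+1) x -> x \in [:: a i; a i.+2; b i.+1].
  apply: uniq_turn_nbr => //; first exact: sy.
  by rewrite /= !inE !dist; case: n56 => ->; lia.
have an : n.-1.+1 = n by case: n56 => ->.
have aa' : adj (a 0) (a n.-1) by rewrite -a0 -an sy.
have cb' : adj (b 0) (c n.-1) by rewrite -b0 -an sy.
set p := [:: c 0; b 1; a 1; a 0; b 0].
have c1a2 : connect (adj_avoiding [set v in p]) (c 1) (a 2).
  by apply: (@connect_avoiding_path2 _ _ (b 2));
    rewrite ?inE ?dist ?[adj (b _) (a _)]adj_sym //; case: n56 => ->.
have ana2 : connect (adj_avoiding [set v in p]) (a n.-1) (a 2).
  case: n56 => nE; rewrite nE in dist *.
    by apply: (@connect_avoiding_path2 _ _ (a 3)); rewrite ?inE ?dist // adj_sym.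
  apply: (connect_trans (y := a 4)); first by apply: connect1; rewrite /adj_avoiding adj_sym aa !inE !dist.
  by apply: (@connect_avoiding_path2 _ _ (a 3)); rewrite ?inE ?dist // adj_sym.
have cna2 : connect (adj_avoiding [set v in p]) (c n.-1) (a 2).
  apply: connect_trans ana2.
  apply: (@connect_avoiding_path2 _ _ (b n.-1)); rewrite ?[adj (c _) _]adj_sym ?[adj (b _) (a _)]adj_sym //;
    by case: n56 dist => -> dist; rewrite !inE !dist.
(* [c 0] is the distinguished vertex since its third neighbour is the only one not known; the four
   known exits are joined to [a 2] inside the cap. *)
apply: (@pentagon_turns F F_full (c 0) (b 1) (a 1) (a 0) (b 0) (c 1) (a 2) (a n.-1) (c n.-1)).
- by case: n56 dist => -> dist; rewrite /= !inE !dist.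
- by rewrite /= andbT; apply/and5P; split=> //; apply: sy.
- by case: n56 dist => -> dist; rewrite /= !inE !dist.
- by rewrite aa' cb' bc aa.
- move=> t ct; rewrite !inE => /or4P[/eqP tE|->//|/eqP tE|]; rewrite ?orbT //.
  + by rewrite tE adj_irr in ct.
  + by have := nbr_a 0 (c 0); rewrite -tE sy // !inE !dist tE !dist => /(_ isT).
  + case/orP => [/eqP tE|->]; last by rewrite orbT.
    by have := nbr_a n.-1 (c 0); rewrite an a0 -tE sy // !inE tE !dist => /(_ isT).
- by move=> t; rewrite !inE => /or3P[]/eqP->.
Qed.

Lemma cap_pentagon a b c i : cap a b c -> pentagon_left a b c i \/ pentagon_right a b c i.
Proof. by move/(cap_shift i)/cap_pentagon0. Qed.

Record oriented_cap a b c : Prop := OrientedCap {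
  ocap_cap :> cap a b c;
  ocap_a : forall i, turn (a i.+1) (a i.+2) (b i.+1) (a i);
  ocap_b : forall i, turn (b i.+1) (a i.+1) (c i.+1) (c i);
  ocap_c : forall i, r (c i) (b i) = b i.+1 }.

Lemma oriented_cap_of_left a b c : cap a b c -> pentagon_left a b c 0 -> oriented_cap a b c.
Proof.
move=> C left0; have [aa ab bc cb aE bE cE a_b a_c b_c] := C.
have b_a i j : (b i == a j) = false by rewrite eq_sym a_b.
have dist := (aE, bE, cE, a_b, a_c, b_c, b_a).
have ne2 i : (i == i.+2 %[mod n]) = false by case: n56 => ->; lia.
have ne1 i : (i.+1 == i %[mod n]) = false by case: n56 => ->; lia.
have left i : pentagon_left a b c i.
  (* Consecutive pentagons share the edge from [a i.+1] to [b i.+1]; opposite directions would make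
     both [a i] and [a i.+2] follow [b i.+1] around [a i.+1]. *)
  elim: i => // i [_ _ E _ _]; case: (cap_pentagon i.+1 C) => // -[_ _ _ E' _].
  by have := eqxx (a i); rewrite -{1}E E' aE eq_sym ne2.
split=> // i; last by case: (left i).
  apply/turn_shift/turn_shift/turn_of_rot => //; last by case: (left i).
    by rewrite adj_sym.
  by rewrite /= !inE !dist ne2.
apply: turn_of_rot => //.
- by rewrite adj_sym.
- by rewrite adj_sym.
- by rewrite /= !inE !dist ne1.
- by case: (left i.+1).
Qed.

(* Reversing the labels turns one orientation of the cap into the other. *)
Lemma oriented_cap_exists a b c : cap a b c ->
  exists a' b' c', oriented_cap a' b' c'.
Proof.
move=> C; case: (cap_pentagon0 C) => [l|[_ _ _ a1E _]].
  by exists a, b, c; apply: oriented_cap_of_left.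
have C' := cap_reflect C; case: (cap_pentagon0 C') => [l|[_ _ _ a1E' _]].
  by exists (reflect_cap a 0), (reflect_cap b 0), (reflect_cap c 1); apply: oriented_cap_of_left.
have := eqxx (a 1); rewrite -{1}a1E; move: a1E'.
rewrite /reflect_cap /= !muln0 => ->; rewrite (cap_aE C).
by case: n56 => ->.
Qed.

End Cap.

(** * The faces around an oriented cap *)

Section OrientedCap.
Variables (F : plane_graph) (n : nat) (a b c : nat -> F).
Hypotheses (n56 : n = 5 \/ n = 6) (F_full : fullerene F) (O : oriented_cap n a b c).
Implicit Types (v w : F) (i j k : nat).
Local Notation r := (@Defs.rot F).
Local Notation fn := (face_next r).
Let F3 : cubic F := fullerene_cubic F_full.
Let sy v w : adj v w -> adj w v. Proof. by rewrite adj_sym. Qed.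

(* The face of [outer_dart i] runs through c_(i+1), b_(i+1), c_i, u_i, x_i; it is
   a pentagon if x_i is u_(i+1), and otherwise x_i is followed by u_(i+1). *)
Definition outer i := r (c i) (b i.+1).
Definition outer_next i := r (outer i) (c i).
Definition outer_prev i := r (outer i) (outer_next i).
Local Notation u := outer.
Local Notation x := outer_next.
Local Notation y := outer_prev.

Definition outer_dart i := (c i.+1, b i.+1).
Definition outer_hex i := fingraph.order fn (outer_dart i) == 6.

Let aE i j : (a i == a j) = (i == j %[mod n]). Proof. exact: cap_aE O _ _. Qed.
Let bE i j : (b i == b j) = (i == j %[mod n]). Proof. exact: cap_bE O _ _. Qed.
Let cE i j : (c i == c j) = (i == j %[mod n]). Proof. exact: cap_cE O _ _. Qed.
Let a_b i j : (a i == b j) = false. Proof. exact: cap_a_b O _ _. Qed.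
Let a_c i j : (a i == c j) = false. Proof. exact: cap_a_c O _ _. Qed.
Let b_c i j : (b i == c j) = false. Proof. exact: cap_b_c O _ _. Qed.
Let b_a i j : (b i == a j) = false. Proof. by rewrite eq_sym. Qed.
Let c_a i j : (c i == a j) = false. Proof. by rewrite eq_sym. Qed.
Let c_b i j : (c i == b j) = false. Proof. by rewrite eq_sym. Qed.

Let a_mod i j : i = j %[mod n] -> a i = a j. Proof. by move=> ij; apply/eqP; rewrite aE ij. Qed.
Let b_mod i j : i = j %[mod n] -> b i = b j. Proof. by move=> ij; apply/eqP; rewrite bE ij. Qed.
Let c_mod i j : i = j %[mod n] -> c i = c j. Proof. by move=> ij; apply/eqP; rewrite cE ij. Qed.
Let next_mod i j : i = j %[mod n] -> i.+1 = j.+1 %[mod n].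
Proof. by move=> ij; apply/eqP; rewrite -(addn1 i) -(addn1 j) eqn_modDr ij. Qed.
Let u_mod i j : i = j %[mod n] -> u i = u j.
Proof.
by move=> ij; rewrite /u (c_mod ij) (b_mod (next_mod ij)).
Qed.
Let x_mod i j : i = j %[mod n] -> x i = x j.
Proof. by move=> ij; rewrite /x (c_mod ij) (u_mod ij). Qed.
Let y_mod i j : i = j %[mod n] -> y i = y j.
Proof. by move=> ij; rewrite /y (u_mod ij) (x_mod ij). Qed.
Let pred_mod i : exists k, i = k.+1 %[mod n].
Proof. by exists (i + n.-1); case: n56 => ->; lia. Qed.

Lemma outer_turn_c i : turn (c i) (b i) (b i.+1) (u i).
Proof. by apply: turnP (ocap_c O i) => //; apply/sy/(cap_bc O). Qed.

Lemma adj_outer i : adj (c i) (u i).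
Proof. by rewrite (turn_adj (outer_turn_c i)) !inE eqxx !orbT. Qed.

Lemma outer_turn i : turn (u i) (c i) (x i) (y i).
Proof. by apply: turnP => //; apply/sy/adj_outer. Qed.

Lemma nbr_a i v : adj (a i) v -> (exists j, v = a j) \/ v = b i.
Proof.
have [k ik] := pred_mod i; rewrite (a_mod ik) (b_mod ik) (turn_adj (ocap_a O k)) !inE.
by case/or3P=> /eqP->; [left; exists k.+2|right|left; exists k].
Qed.

Lemma nbr_b i v : adj (b i) v -> v = a i \/ exists2 j, v = c j & i = j %[mod n] \/ i = j.+1 %[mod n].
Proof.
have [k ik] := pred_mod i; rewrite (b_mod ik) (a_mod ik) (turn_adj (ocap_b O k)) !inE.
by case/or3P=> /eqP->; [left|right; exists k.+1; auto|right; exists k; auto].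
Qed.

Lemma nbr_c i v : adj (c i) v -> (exists j, v = b j) \/ v = u i.
Proof.
rewrite (turn_adj (outer_turn_c i)) !inE.
by case/or3P=> /eqP->; [left; exists i|left; exists i.+1|right].
Qed.

Lemma outer_neq_b i j : (u i == b j) = false.
Proof.
apply/negP=> /eqP uE; have := adj_outer i; rewrite uE adj_sym => /nbr_b[/eqP|[k /eqP ck jk]].
  by rewrite c_a.
have := turn_neq (outer_turn_c i); rewrite uE /= !inE !negb_or !bE.
move: ck jk; rewrite cE => /eqP ik; case=> [jk|jk].
  by rewrite ik jk eqxx !andbF.
by rewrite jk (next_mod ik) eqxx !andbF.
Qed.

Lemma outer_neq_a i j : (u i == a j) = false.
Proof.
apply/negP=> /eqP uE; have := adj_outer i; rewrite uE adj_sym => /nbr_a[[k /eqP]|/eqP].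
  by rewrite c_a.
by rewrite c_b.
Qed.

Lemma outer_next_dart i k : iter (k + 3) fn (outer_dart i) = iter k fn (u i, x i).
Proof.
rewrite iterD /= /outer_dart /face_next /=.
by rewrite (turn23 (ocap_b O i)).
Qed.

Let adj_dart i : adj (outer_dart i).1 (outer_dart i).2.
Proof. exact/sy/(cap_bc O). Qed.

(** A face that leaves [c i.+1] for [b i.+1] must have come from [u i.+1]; this determines the last
    darts of the outer face, read backwards. The same holds for [outer_hexP]. *)
Lemma outer_pent i : ~~ outer_hex i -> x i = u i.+1 /\ y i.+1 = u i.
Proof.
rewrite /outer_hex; case: (face_length F_full (adj_dart i)) => o5; rewrite o5 // => _.
have := iter_order (@face_next_inj F) (outer_dart i); rewrite o5 (outer_next_dart i 2) /=.
rewrite /face_next /= => -[E1]; rewrite E1 -(turn31 (outer_turn_c i.+1)) => /perm_inj xE.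
split=> //; move: E1; rewrite xE -(turn31 (outer_turn i.+1)) => /perm_inj ->//.
Qed.

Lemma outer_hexP i : outer_hex i -> x i = y i.+1 /\ r (x i) (u i) = u i.+1.
Proof.
move=> /eqP o6.
have := iter_order (@face_next_inj F) (outer_dart i); rewrite o6 (outer_next_dart i 3) /=.
rewrite /face_next /= => -[E1]; rewrite E1 -(turn31 (outer_turn_c i.+1)) => /perm_inj sE.
by split=> //; move: E1; rewrite sE -(turn31 (outer_turn i.+1)) => /perm_inj ->.
Qed.

Lemma outer_x i : (x i = u i.+1 /\ y i.+1 = u i) \/ (x i = y i.+1 /\ r (x i) (u i) = u i.+1).
Proof. by have [/outer_hexP|/outer_pent] := boolP (outer_hex i); [right|left]. Qed.

(* The outer face along a chord makes c_(i+1) and c_(i+d-1) adjacent too, so the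
   chords shrink to a loop or a triangle. *)
Lemma no_chord d i : u i != c (i + d).
Proof.
elim/ltn_ind: d i => -[|[|d]] IHd i; apply/eqP=> uE.
- by have := adj_outer i; rewrite uE addn0 adj_irr.
- rewrite addn1 in uE; have xE : x i = b i.+1.
    rewrite /x uE; have : adj (c i.+1) (c i) by rewrite -uE sy // adj_outer.
    by case/nbr_c=> [[j /eqP]|->]; rewrite ?c_b ?(turn31 (outer_turn_c _)).
  have /(short_face F_full (adj_dart i)) : iter 3 fn (outer_dart i) = outer_dart i.
    by rewrite (outer_next_dart i 0) /= uE xE.
  by move/(_ isT).
have cc : adj (c (i + d.+2)) (c i) by rewrite -uE sy // adj_outer.
have uE' : u (i + d.+2) = c i.
  by case: (nbr_c cc) => [[j /eqP]|->]; rewrite ?c_b.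
have xE : x i = b (i + d.+2).
  by rewrite /x uE -uE' (turn31 (outer_turn_c _)).
case: (outer_x i) => [[E _]|[_]].
  by have := outer_neq_b i.+1 (i + d.+2); rewrite -E xE eqxx.
rewrite xE uE addnS (turn23 (ocap_b O _)) => E.
by have := IHd d (ltnW (ltnSn _)) i.+1; rewrite -E addSnnS eqxx.
Qed.

Lemma outer_neq_c i j : (u i == c j) = false.
Proof.
(* [j + n * i - i] is a natural representative of j - i modulo [n]. *)
apply/negbTE; rewrite (@c_mod j (i + (j + n * i - i))) ?no_chord //.
by case: n56 => ->; lia.
Qed.

(** If two rim vertices had the same outer neighbour, one would follow the other in the rotation
    there, say [x k = c l]. Then the outer face would continue to [b l], where an outer vertex is
    required. *)
Lemma outerE i j : (u i == u j) = (i == j %[mod n]).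
Proof.
apply/eqP/eqP=> [uE|]; last exact: u_mod.
apply/eqP; rewrite -cE; apply: contraT => cij.
suff side k l : u k = u l -> r (u k) (c k) != c l.
  have ci := adj_outer i; have cj := adj_outer j.
  have T := outer_turn i; have : adj (u i) (c j) by rewrite uE sy.
  rewrite (turn_adj T) !inE eq_sym (negbTE cij) /= => /orP[]/eqP cE'.
    by have := side i j uE; rewrite -/(x i) -cE' eqxx.
  by have := side j i (esym uE); rewrite -uE cE' (turn31 T) eqxx.
move=> ukl; apply/eqP=> E; have xE : x k = c l by [].
case: (outer_x k) => [[E' _]|[_]].
  by have := outer_neq_c k.+1 l; rewrite -E' xE eqxx.
rewrite xE ukl (turn31 (outer_turn_c l)) => E'.
by have := outer_neq_b k.+1 l; rewrite -E' eqxx.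
Qed.

Lemma nbr_outer i v : adj (u i) v -> v != c i ->
  [/\ forall j, v != a j, forall j, v != b j & forall j, v != c j].
Proof.
move=> uv vc; split=> j; apply/eqP=> vE; have := sy uv; rewrite vE.
- by case/nbr_a=> [[k /eqP]|/eqP]; rewrite ?outer_neq_a ?outer_neq_b.
- by case/nbr_b=> [/eqP|[k /eqP]]; rewrite ?outer_neq_a ?outer_neq_c.
- case/nbr_c=> [[k /eqP]|/eqP]; rewrite ?outer_neq_b // outerE => ij.
  by move: vc; rewrite vE cE eq_sym ij.
Qed.

Lemma adj_outer_next i : adj (u i) (x i).
Proof. by rewrite (turn_adj (outer_turn i)) !inE eqxx orbT. Qed.

Lemma adj_outer_prev i : adj (u i) (y i).
Proof. by rewrite (turn_adj (outer_turn i)) !inE eqxx !orbT. Qed.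

Lemma outer_next_neq_prev i : x i != y i.
Proof. by have := turn_neq (outer_turn i); rewrite /= !inE => /and4P[]. Qed.

Lemma outer_next_neq_c i : x i != c i.
Proof. by have := turn_neq (outer_turn i); rewrite eq_sym /= !inE => /and4P[_ /norP[]]. Qed.

Lemma hex_outer_sym i j : outer_hex i -> x i = u j -> outer_hex j /\ x j = u i.
Proof.
move=> hi xu; have [xy rx] := outer_hexP hi.
have T := outer_turn j; have := adj_outer_next i; rewrite xu adj_sym (turn_adj T) !inE.
rewrite outer_neq_c /= => /orP[]/eqP E.
  split=> //; apply: contraT => /outer_pent[xj yj]; move: xj yj; rewrite -E => /eqP.
  rewrite outerE => /eqP ij; rewrite -(y_mod ij) => yi.
  by have := outer_next_neq_prev i; rewrite xu yi eqxx.
move: rx; rewrite xu E (turn31 T) => /eqP.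
by rewrite eq_sym outer_neq_c.
Qed.

(** Hexagon [i] leaves [u j.+1] for [u i.+1], which is therefore [y j.+1], and on an outer hexagon
    [j] that vertex is [x j]. *)
Lemma hex_outer_pred i j : outer_hex i -> x i = u j.+1 -> outer_hex j /\ x j = u i.+1.
Proof.
move=> hi xu; have [xy rx] := outer_hexP hi; have [hj xj] := hex_outer_sym hi xu.
have yj : y j.+1 = u i.+1 by rewrite -rx xu -xj.
have hj' : outer_hex j.
  apply: contraT => /outer_pent[xj' yj']; move: yj; rewrite yj' => /eqP; rewrite outerE => /eqP ij.
  have := outer_next_neq_prev i.+1; rewrite -xy xu -(x_mod ij) xj' eqxx //.
by split=> //; have [-> _] := outer_hexP hj'.
Qed.

(** Applying [hex_outer_pred] and then [hex_outer_sym] moves the coincidence to [i.+1] and lowers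
    [d] by two; for [d] equal to 0 or 1 it is a loop. *)
Lemma hex_outer_next_neq d i : outer_hex i -> x i != u (i + d).
Proof.
elim/ltn_ind: d i => -[|[|d]] IHd i hi; apply/eqP=> xu.
- by have := adj_outer_next i; rewrite xu addn0 adj_irr.
- have [xy _] := outer_hexP hi; have := adj_outer_prev i.+1.
  by rewrite -xy xu addn1 adj_irr.
have [h1 x1] := hex_outer_pred hi (etrans xu (congr1 u (addnS i d.+1))).
have [h2 x2] := hex_outer_sym h1 x1.
by have := IHd d (ltnW (ltnSn _)) i.+1 h2; rewrite x2 addSnnS eqxx.
Qed.

Lemma hex_outer_nextE i j : outer_hex i -> (x i == u j) = false.
Proof.
move=> hi; apply/negbTE; rewrite (@u_mod j (i + (j + n * i - i))) ?hex_outer_next_neq //.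
by case: n56 => ->; lia.
Qed.

Lemma outer_hex_darts i : outer_hex i -> face_of r (outer_dart i) =i
  [:: (c i.+1, b i.+1); (b i.+1, c i); (c i, u i); (u i, x i); (x i, u i.+1); (u i.+1, c i.+1)].
Proof.
move=> hi d; rewrite inE fconnect_orbit /fingraph.orbit (eqP hi) /= /face_next /=.
have [xy rx] := outer_hexP hi.
rewrite (turn23 (ocap_b O i)) -!/(u i) -!/(x i) rx.
by rewrite xy (turn31 (outer_turn i.+1)).
Qed.

Lemma outer_hex_vertices i : outer_hex i -> face_vertices (face_of r (outer_dart i)) =
  [set v in [:: c i.+1; b i.+1; c i; u i; x i; u i.+1]].
Proof.
move=> hi; apply/setP=> v; rewrite !inE; apply/imsetP/idP=> [[d]|].
  by rewrite outer_hex_darts // !inE => + ->; do !case/orP; move/eqP=> ->; rewrite eqxx ?orbT.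
move=> vE; have: v \in [seq d.1 | d <- [:: (c i.+1, b i.+1); (b i.+1, c i); (c i, u i);
    (u i, x i); (x i, u i.+1); (u i.+1, c i.+1)]] by rewrite !inE.
by case/mapP=> d dE ->; exists d; rewrite ?outer_hex_darts.
Qed.

Definition inner_dart i := (a i, a i.+1).

Lemma inner_dart_iter i k : iter k fn (inner_dart i) = inner_dart (i + k).
Proof.
elim: k => [|k IHk]; first by rewrite addn0.
by rewrite iterS IHk /face_next /inner_dart /= (turn31 (ocap_a O _)) addnS.
Qed.

Lemma inner_order : n = 6 -> fingraph.order fn (inner_dart 0) = 6.
Proof.
move=> n6; have ad : adj (inner_dart 0).1 (inner_dart 0).2 by apply: cap_aa O _.
case: (face_length F_full ad) => // o5; have := iter_order (@face_next_inj F) (inner_dart 0).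
rewrite o5 inner_dart_iter => -[/eqP].
by rewrite aE n6.
Qed.

Lemma inner_darts : n = 6 -> face_of r (inner_dart 0) =i [seq inner_dart i | i <- iota 0 6].
Proof.
move=> n6 d; rewrite inE fconnect_orbit /fingraph.orbit inner_order //.
rewrite (_ : traject _ _ _ = [seq inner_dart i | i <- iota 0 6]) //.
by apply: (@eq_from_nth _ (inner_dart 0)) => [|k]; rewrite size_traject ?size_map ?size_iota // => k6;
  rewrite nth_traject // inner_dart_iter (nth_map 0) ?size_iota // nth_iota.
Qed.

Lemma inner_vertices v : n = 6 -> v \in face_vertices (face_of r (inner_dart 0)) -> exists i, v = a i.
Proof.
move=> n6 /imsetP[d]; rewrite inner_darts // => /mapP[i _ ->] ->; by exists i.
Qed.

End OrientedCap.

(** * Perfect matchings and alternating faces *)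

Section Matching.
Variables (F : plane_graph) (M : {set {set F}}).
Hypothesis M_perfect : perfect_matching M.
Implicit Types v w : F.
Local Notation r := (@Defs.rot F).
Local Notation fn := (face_next r).

Definition matched v w := [set v; w] \in M.

Lemma matched_sym v w : matched v w -> matched w v.
Proof. by rewrite /matched setUC. Qed.

Lemma matched_unique v w w' : matched v w -> matched v w' -> w = w'.
Proof.
move=> vw vw'; have [_ /(_ v)/eqP/cards1P[e eE]] := M_perfect.
have mem z : matched v z -> [set v; z] = e.
  by move=> vz; apply/set1P; rewrite -eE inE set21 andbT.
have /eqP := etrans (mem _ vw) (esym (mem _ vw')).
by rewrite set2_eq !xpair_eqE => /orP[/andP[_ /eqP]//|/andP[/eqP <- /eqP]].
Qed.

Lemma matched_ex v : exists2 w, adj v w & matched v w.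
Proof.
have [M_edges /(_ v)/eqP/cards1P[e eE]] := M_perfect.
have: e \in [set e in M | v \in e] by rewrite eE set11.
rewrite inE => /andP[eM ve]; have /imsetP[[p q]] := subsetP M_edges _ eM.
rewrite inE /= => pq eE'; move: ve eM; rewrite eE' => /set2P[->|->] eM.
  by exists q.
by exists p; [rewrite adj_sym | rewrite /matched setUC].
Qed.

(** Exactly one of the two consecutive face edges at [d.2] is in [M], so a vertex of an alternating
    face has its partner on that face. *)
Lemma alternating_matched f d : alternating M f -> d \in f ->
  matched d.2 d.1 \/ matched d.2 (fn d).2.
Proof.
move=> alt df; have := alt d df; rewrite /matched [[set d.2; d.1]]setUC.
by case: (_ \in M) => /=; [left|case: (_ \in M) => //; right].
Qed.

Lemma turn_matched v y1 y2 y3 : turn v y1 y2 y3 -> [\/ matched v y1, matched v y2 | matched v y3].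
Proof.
move=> T; have [w] := matched_ex v; rewrite (turn_adj T) !inE.
by case/or3P=> /eqP->; [constructor 1|constructor 2|constructor 3].
Qed.

Lemma matched_clash v w w' : matched v w -> matched v w' -> w == w' = false -> False.
Proof. by move=> vw /(matched_unique vw)->; rewrite eqxx. Qed.

End Matching.

(** * Pairs of disjoint hexagons that are not resonant *)

Section Resonance.
Variables (F : plane_graph) (n : nat) (a b c : nat -> F).
Hypotheses (n56 : n = 5 \/ n = 6) (F_full : fullerene F) (O : oriented_cap n a b c).
Implicit Types (v w : F) (i j k : nat).
Local Notation r := (@Defs.rot F).
Local Notation fn := (face_next r).
Local Notation u := (outer b c).
Local Notation x := (outer_next b c).

Let aE i j : (a i == a j) = (i == j %[mod n]). Proof. exact: cap_aE O _ _. Qed.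
Let bE i j : (b i == b j) = (i == j %[mod n]). Proof. exact: cap_bE O _ _. Qed.
Let cE i j : (c i == c j) = (i == j %[mod n]). Proof. exact: cap_cE O _ _. Qed.
Let uE i j : (u i == u j) = (i == j %[mod n]). Proof. exact: outerE O _ _. Qed.
Let a_b i j : (a i == b j) = false. Proof. exact: cap_a_b O _ _. Qed.
Let a_c i j : (a i == c j) = false. Proof. exact: cap_a_c O _ _. Qed.
Let b_c i j : (b i == c j) = false. Proof. exact: cap_b_c O _ _. Qed.
Let u_a i j : (u i == a j) = false. Proof. exact: outer_neq_a O _ _. Qed.
Let u_b i j : (u i == b j) = false. Proof. exact: outer_neq_b O _ _. Qed.
Let u_c i j : (u i == c j) = false. Proof. exact: outer_neq_c O _ _. Qed.
Let b_a i j : (b i == a j) = false. Proof. by rewrite eq_sym. Qed.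
Let c_a i j : (c i == a j) = false. Proof. by rewrite eq_sym. Qed.
Let c_b i j : (c i == b j) = false. Proof. by rewrite eq_sym. Qed.
Let a_u i j : (a i == u j) = false. Proof. by rewrite eq_sym. Qed.
Let b_u i j : (b i == u j) = false. Proof. by rewrite eq_sym. Qed.
Let c_u i j : (c i == u j) = false. Proof. by rewrite eq_sym. Qed.
Let dist := (aE, bE, cE, uE, a_b, a_c, b_c, u_a, u_b, u_c, b_a, c_a, c_b, a_u, b_u, c_u).

Lemma two_hexagons_resonant d1 d2 : k_resonant F 2 -> adj d1.1 d1.2 -> adj d2.1 d2.2 ->
    fingraph.order fn d1 = 6 -> fingraph.order fn d2 = 6 ->
    [disjoint face_vertices (face_of r d1) & face_vertices (face_of r d2)] ->
  exists M, [/\ perfect_matching M, alternating M (face_of r d1) & alternating M (face_of r d2)].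
Proof.
move=> res ad1 ad2 o1 o2 dis; case: (res [set face_of r d1; face_of r d2]).
- by apply/subsetP=> f /set2P[]->; rewrite inE mem_faces // card_face ?o1 ?o2.
- move=> f g /set2P[]-> /set2P[]->; rewrite ?eqxx //.
  by rewrite disjoint_sym.
- by rewrite cards2; case: (_ != _).
by move=> M [Mp Ma]; exists M; split=> //; apply: Ma; rewrite !inE eqxx ?orbT.
Qed.

Lemma outer_hex_matched M i : perfect_matching M -> alternating M (face_of r (outer_dart b c i)) ->
    outer_hex b c i ->
  [/\ matched M (c i.+1) (u i.+1) \/ matched M (c i.+1) (b i.+1),
      matched M (b i.+1) (c i.+1) \/ matched M (b i.+1) (c i)
    & matched M (c i) (b i.+1) \/ matched M (c i) (u i)].
Proof.
move=> Mp Ma hi; have dE := outer_hex_darts F_full O hi.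
split.
- have := alternating_matched (d := (u i.+1, c i.+1)) Ma; rewrite dE !inE eqxx ?orbT => /(_ isT).
  by rewrite /= (turn31 (outer_turn_c F_full O _)).
- have := alternating_matched (d := (c i.+1, b i.+1)) Ma; rewrite dE !inE eqxx ?orbT => /(_ isT).
  by rewrite /= (turn23 (ocap_b O _)).
- have := alternating_matched (d := (b i.+1, c i)) Ma; rewrite dE !inE eqxx ?orbT => /(_ isT).
  by rewrite /=.
Qed.

Let adj_dart i : adj (outer_dart b c i).1 (outer_dart b c i).2.
Proof. by rewrite adj_sym; apply: cap_bc O _. Qed.

(* The vertices b_2, ..., b_6 are forced in turn to be matched to c_2, ..., c_6,
   but c_6 = c_0 belongs to the outer hexagon. *)
Lemma hexagonal_cap_outer_hex_not_resonant : n = 6 -> outer_hex b c 0 -> ~ k_resonant F 2.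
Proof.
move=> n6 h0 res; have ad : adj (inner_dart a 0).1 (inner_dart a 0).2 by apply: cap_aa O _.
have [|M [Mp Ma M0]] := two_hexagons_resonant res ad (adj_dart 0) (inner_order F_full O n6) (eqP h0).
  rewrite disjoint_subset; apply/subsetP=> v /(inner_vertices F_full O n6)[i ->].
  rewrite inE (outer_hex_vertices F_full O h0) !inE !dist /=.
  have xa :=
      nbr_outer n56 F_full O (adj_outer_next F_full O 0) (outer_next_neq_c F_full O 0).
  by case: xa => /(_ i) + _ _; rewrite eq_sym orbF => /negbTE->.
have [c1 _ c0] := outer_hex_matched Mp M0 h0.
have in_a i : i < 6 -> exists j, matched M (a i.+1) (a j).
  move=> i6; have [|m|m] := alternating_matched (d := inner_dart a i) Ma.
  - rewrite (inner_darts F_full O n6); apply: map_f.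
    by rewrite mem_iota.
  - by exists i.
  - by exists i.+2; move: m; rewrite /= (turn31 (ocap_a O _)).
have step j : j < 6 -> ~ matched M (c j) (b j.+1) -> matched M (b j.+1) (c j.+1).
  move=> j6 cb; case: (turn_matched Mp (ocap_b O j)) => // m; last first.
    by case: cb; apply: matched_sym.
  have [k ak] := in_a j j6.
  by have := matched_unique Mp ak (matched_sym m) => /eqP; rewrite dist.
have nexts j : 0 < j < 5 -> matched M (b j.+1) (c j.+1) -> matched M (b j.+2) (c j.+2).
  move=> /andP[j0 j5] m; apply: step => [|m']; first by [].
  apply: (matched_clash Mp (matched_sym m) m'); rewrite bE n6.
  by move: j j0 j5 {m m'}; do 6!case=> //.
have m2 : matched M (b 2) (c 2).
  by apply: step => // m; case: c1 => m'; apply: (matched_clash Mp m m'); rewrite dist ?n6.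
have m6 := nexts 4 isT (nexts 3 isT (nexts 2 isT (nexts 1 isT m2))).
have c6 : c 6 = c 0 by apply/eqP; rewrite dist n6.
move/matched_sym: m6; rewrite c6 => m6.
by case: c0 => m; apply: (matched_clash Mp m6 m); rewrite dist ?n6.
Qed.

Lemma pentagonal_cap_outer_hexes_not_resonant : n = 5 ->
  outer_hex b c 0 -> outer_hex b c 2 -> ~ k_resonant F 2.
Proof.
move=> n5 h0 h2 res.
have xdist i j : outer_hex b c i -> [/\ (x i == a j) = false, (x i == b j) = false,
    (x i == c j) = false & (x i == u j) = false].
  move=> hi; have [xa xb xc] :=
      nbr_outer n56 F_full O (adj_outer_next F_full O i) (outer_next_neq_c F_full O i).
  by split; rewrite ?(hex_outer_nextE n56 F_full O j hi) //; apply/negbTE.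
(* A common vertex would have the four neighbours [u 0], [u 1], [u 2] and [u 3]. *)
have x02 : x 0 != x 2.
  apply/eqP=> E.
  have ux i : adj (x i) (u i) by rewrite adj_sym (adj_outer_next F_full O).
  have ux' i : outer_hex b c i -> adj (x i) (u i.+1).
    by move=> /(outer_hexP F_full O)[-> _]; rewrite adj_sym (adj_outer_prev F_full O).
  have := uniq_turn_nbr F_full (ux 0) (ux' 0 h0) (y3 := u 2) (z := u 3).
  rewrite {1 2}E ux ux' //= !inE !dist n5.
  by move/(_ isT isT isT).
have x0 j := xdist 0 j h0; have x2 j := xdist 2 j h2.
have [|M [Mp M0 M2]] := two_hexagons_resonant res (adj_dart 0) (adj_dart 2) (eqP h0) (eqP h2).
  rewrite disjoint_subset (outer_hex_vertices F_full O h0) (outer_hex_vertices F_full O h2).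
  apply/subsetP=> v; rewrite !inE.
  have [bx cx ux] : [/\ forall j, (b j == x 2) = false, forall j, (c j == x 2) = false
      & forall j, (u j == x 2) = false].
    by split=> j; rewrite eq_sym; case: (x2 j).
  have [xb xc xu] : [/\ forall j, (x 0 == b j) = false, forall j, (x 0 == c j) = false
      & forall j, (x 0 == u j) = false].
    by split=> j; case: (x0 j).
  by do !case/orP; move/eqP->; rewrite ?(dist, bx, cx, ux, xb, xc, xu, negbTE x02, n5).
have [c1 b1 c0] := outer_hex_matched Mp M0 h0.
have [c3 b3 c2] := outer_hex_matched Mp M2 h2.
have clash := matched_clash Mp.
have ms := @matched_sym F M.
(* The hexagons keep [c 1] and [c 2] from [b 2], which takes [a 2]; then [a 1] takes [a 0], [a 3]
   takes [a 4], and [b 4] takes [c 4]. Nothing remains for [b 5], whose neighbours are [a 0], [c 0]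
   and [c 4]. *)
have m22 : matched M (b 2) (a 2).
  case: (turn_matched Mp (ocap_b O 1)) => // /ms m.
    by case: c2 => m'; case: (clash _ _ _ m m'); rewrite dist ?n5.
  by case: c1 => m'; case: (clash _ _ _ m m'); rewrite dist ?n5.
have m10 : matched M (a 1) (a 0).
  case: (turn_matched Mp (ocap_a O 0)) => // /ms m.
    by case: (clash _ _ _ m (ms _ _ m22)); rewrite dist.
  by case: b1 => m'; case: (clash _ _ _ m m'); rewrite dist.
have m34 : matched M (a 3) (a 4).
  case: (turn_matched Mp (ocap_a O 2)) => // /ms m.
    by case: b3 => m'; case: (clash _ _ _ m m'); rewrite dist.
  by case: (clash _ _ _ m (ms _ _ m22)); rewrite dist.
have m44 : matched M (b 4) (c 4).
  case: (turn_matched Mp (ocap_b O 3)) => // /ms m.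
    by case: (clash _ _ _ m (ms _ _ m34)); rewrite dist.
  by case: c3 => m'; case: (clash _ _ _ m m'); rewrite dist ?n5.
have [a5 c5] : a 5 = a 0 /\ c 5 = c 0 by split; apply/eqP; rewrite dist ?n5.
case: (turn_matched Mp (ocap_b O 4)) => /ms m.
- rewrite a5 in m; case: (clash _ _ _ m (ms _ _ m10)); rewrite dist //.
- by rewrite c5 in m; case: c0 => m'; case: (clash _ _ _ m m'); rewrite dist ?n5.
- by case: (clash _ _ _ m (ms _ _ m44)); rewrite dist ?n5.
Qed.

End Resonance.

(** * Exits from the cap through outer hexagons *)

Section CapClosure.
Variables (F : plane_graph) (n : nat) (a b c : nat -> F).
Hypotheses (n56 : n = 5 \/ n = 6) (F_full : fullerene F) (O : oriented_cap n a b c).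
Implicit Types (v w : F) (i j k : nat).
Local Notation r := (@Defs.rot F).
Local Notation fn := (face_next r).
Local Notation u := (outer b c).
Local Notation x := (outer_next b c).
Local Notation y := (outer_prev b c).
Local Notation hex := (outer_hex b c).
Let F3 : cubic F := fullerene_cubic F_full.

Definition in_cap v := exists j, [\/ v = a j, v = b j, v = c j | v = u j].

Let b_mod i j : i = j %[mod n] -> b i = b j.
Proof. by move=> ij; apply/eqP; rewrite (cap_bE O) ij. Qed.
Let c_mod i j : i = j %[mod n] -> c i = c j.
Proof. by move=> ij; apply/eqP; rewrite (cap_cE O) ij. Qed.
Let next_mod i j : i = j %[mod n] -> i.+1 = j.+1 %[mod n].
Proof. by move=> ij; apply/eqP; rewrite -(addn1 i) -(addn1 j) eqn_modDr ij. Qed.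

Lemma outer_mod i j : i = j %[mod n] -> [/\ u i = u j, x i = x j, y i = y j & hex i = hex j].
Proof.
move=> ij; have uij : u i = u j by rewrite /outer (c_mod ij) (b_mod (next_mod ij)).
have xij : x i = x j by rewrite /outer_next uij (c_mod ij).
split=> //; first by rewrite /outer_prev uij xij.
by rewrite /outer_hex /outer_dart (c_mod (next_mod ij)) (b_mod (next_mod ij)).
Qed.

Lemma outer_prevE i : exists2 k, i = k.+1 %[mod n] &
  (~~ hex k /\ y i = u k) \/ (hex k /\ y i = x k).
Proof.
have [k ik] : exists k, i = k.+1 %[mod n] by exists (i + n.-1); case: n56 => ->; lia.
have [_ _ yE _] := outer_mod ik; exists k => //; rewrite yE.
by have [h|h] := boolP (hex k);
  [right; have [] := outer_hexP F_full O h|left; have [] := outer_pent F_full O h].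
Qed.

Lemma in_cap_adj v w : in_cap v -> adj v w -> in_cap w \/ exists2 k, hex k & w = x k.
Proof.
case=> j [] ->.
- by case/(nbr_a n56 O) => [[k ->]|->]; left; [exists k|exists j]; [constructor 1|constructor 2].
- by case/(nbr_b n56 O) => [->|[k -> _]]; left; [exists j|exists k]; [constructor 1|constructor 3].
- by case/(nbr_c F_full O) => [[k ->]|->]; left; [exists k|exists j]; [constructor 2|constructor 4].
rewrite (turn_adj (outer_turn F_full O j)) !inE => /or3P[]/eqP->.
- by left; exists j; constructor 3.
- have [h|h] := boolP (hex j); first by right; exists j.
  by left; exists j.+1; constructor 4; have [] := outer_pent F_full O h.
have [k _ [[_ ->]|[h ->]]] := outer_prevE j; first by left; exists k; constructor 4.
by right; exists k.
Qed.

Lemma hex_next_not_in_cap k : hex k -> ~ in_cap (x k).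
Proof.
move=> hk [j]; have [xa xb xc] :=
      nbr_outer n56 F_full O (adj_outer_next F_full O k) (outer_next_neq_c F_full O k).
case=> /eqP; rewrite ?(negbTE (xa j)) ?(negbTE (xb j)) ?(negbTE (xc j)) //.
by rewrite (hex_outer_nextE n56 F_full O).
Qed.

(** By [in_cap_adj] the cap can be left only at the vertices [x k] of outer hexagons; if [T] holds
    all of them, a vertex beyond would be separated by [T]. *)
Lemma in_cap_outside (T : {set F}) : #|T| < 3 -> a 0 \notin T ->
  (forall k, hex k -> x k \in T) -> forall v, v \notin T -> in_cap v.
Proof.
move=> T3 a0 hT; apply: (cut_closed F_full T3 a0); first by exists 0; constructor 1.
move=> v w vc vw wT; case: (in_cap_adj vc vw) => // -[k hk wE].
by rewrite wE hT in wT.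
Qed.

Lemma adj_hex_next v k : hex k -> in_cap v -> adj v (x k) -> exists j, v = u j.
Proof.
move=> hk [j vE] vx; have nc := hex_next_not_in_cap hk; exists j.
case: vE vx => -> //.
- by case/(nbr_a n56 O) => [[i E]|E]; case: nc; [exists i|exists j]; [constructor 1|constructor 2].
- by case/(nbr_b n56 O) => [E|[i E _]]; case: nc; [exists j|exists i]; [constructor 1|constructor 3].
by case/(nbr_c F_full O) => [[i E]|E]; case: nc; [exists i|exists j]; [constructor 2|constructor 4].
Qed.

(** * Without outer hexagons the graph is a barrel *)

Section BarrelIso.
Hypothesis no_hex : forall k, ~~ hex k.

Let n_gt0 : 0 < n. Proof. by case: n56 => ->. Qed.

Definition barrel_map (p : barrel n) : F :=
  match nat_of_ord p.1 with 0 => a p.2 | 1 => b p.2 | 2 => c p.2 | _ => u p.2 end.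

Local Notation I k := (@Ordinal 4 k isT).

Let map0 (i : 'I_n) : barrel_map (I 0, i) = a i. Proof. by []. Qed.
Let map1 (i : 'I_n) : barrel_map (I 1, i) = b i. Proof. by []. Qed.
Let map2 (i : 'I_n) : barrel_map (I 2, i) = c i. Proof. by []. Qed.
Let map3 (i : 'I_n) : barrel_map (I 3, i) = u i. Proof. by []. Qed.

Let ordP (k : 'I_4) : [\/ k = I 0, k = I 1, k = I 2 | k = I 3].
Proof.
case: k => [[|[|[|[|]]]] //= k4]; [constructor 1|constructor 2|constructor 3|constructor 4];
by apply: val_inj.
Qed.

Let aS (i : 'I_n) : a (ordS i) = a i.+1.
Proof. by apply/eqP; rewrite (cap_aE O) /= modn_mod. Qed.
Let bS (i : 'I_n) : b (ordS i) = b i.+1.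
Proof. by apply: b_mod; rewrite /= modn_mod. Qed.
Let cS (i : 'I_n) : c (ordS i) = c i.+1.
Proof. by apply: c_mod; rewrite /= modn_mod. Qed.
Let uS (i : 'I_n) : u (ordS i) = u i.+1.
Proof. by have [] := @outer_mod (ordS i) i.+1; rewrite /= ?modn_mod. Qed.

Lemma barrel_map_inj : injective barrel_map.
Proof.
have mod_inj (i j : 'I_n) : (i == j %[mod n]) -> i = j.
  by rewrite !modn_small // => /eqP/val_inj.
move=> [k i] [l j]; case: (ordP k) => ->; case: (ordP l) => ->;
  rewrite ?map0 ?map1 ?map2 ?map3 => /eqP;
  rewrite ?(cap_aE O, cap_bE O, cap_cE O, cap_a_b O, cap_a_c O, cap_b_c O,
    outerE n56 F_full O, outer_neq_a n56 F_full O, outer_neq_b n56 F_full O, outer_neq_c n56 F_full O) //;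
  try (by move/mod_inj->);
  by rewrite eq_sym ?(cap_a_b O, cap_a_c O, cap_b_c O,
    outer_neq_a n56 F_full O, outer_neq_b n56 F_full O, outer_neq_c n56 F_full O).
Qed.

Lemma barrel_map_arc p q : barrel_arc p q -> adj (barrel_map p) (barrel_map q).
Proof.
have u_adj i : adj (u i) (u i.+1).
  by have [<- _] := outer_pent F_full O (no_hex i); apply: adj_outer_next F_full O _.
case: p q => [k i] [l j]; rewrite /barrel_arc /=.
case/or3P=> [/and3P[/eqP<- k03 /eqP->]|/andP[kl /eqP->]|/and3P[k1 l2 /eqP->]].
- case: (ordP k) k03 => -> // _; rewrite ?map0 ?map3 ?aS ?uS //.
  exact: cap_aa O _.
- case: (ordP k) (ordP l) kl => -> [] -> // _; rewrite ?map0 ?map1 ?map2 ?map3.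
  + exact: cap_ab O _.
  + exact: cap_bc O _.
  + exact: adj_outer F_full O _.
case: (ordP k) k1 => -> // _; case: (ordP l) l2 => -> // _.
by rewrite map1 map2 bS adj_sym; apply: cap_cb O _.
Qed.

(** This makes the map reflect adjacency: the turns list all neighbours of an image vertex, and each
    comes from a barrel edge. *)
Lemma barrel_map_nbr p v : adj (barrel_map p) v ->
  exists2 q, v = barrel_map q & barrel_arc p q || barrel_arc q p.
Proof.
(* The index is written as a successor because the turns of an oriented cap are stated at [i.+1]. *)
case: p => [k i0]; rewrite -(ord_predK i0); move: (ord_pred i0) => {i0} i.
case: (ordP k) => ->; rewrite ?map0 ?map1 ?map2 ?map3 ?aS ?bS ?cS ?uS.
- rewrite (turn_adj (ocap_a O i)) !inE => /or3P[]/eqP->.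
  + exists (I 0, ordS (ordS i)); last by rewrite /barrel_arc /= !eqxx.
    by rewrite map0; apply/esym/eqP; rewrite (cap_aE O) /= -(addn1 (_ %% _)) modn_mod modnDml addn1.
  + by exists (I 1, ordS i); rewrite ?map1 ?bS // /barrel_arc /= !eqxx ?orbT.
  + by exists (I 0, i); rewrite ?map0 // /barrel_arc /= !eqxx ?orbT.
- rewrite (turn_adj (ocap_b O i)) !inE => /or3P[]/eqP->.
  + by exists (I 0, ordS i); rewrite ?map0 ?aS // /barrel_arc /= !eqxx ?orbT.
  + by exists (I 2, ordS i); rewrite ?map2 ?cS // /barrel_arc /= !eqxx ?orbT.
  + by exists (I 2, i); rewrite ?map2 // /barrel_arc /= !eqxx ?orbT.
- rewrite -cS (turn_adj (outer_turn_c F_full O _)) !inE => /or3P[]/eqP->.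
  + by exists (I 1, ordS i); rewrite ?map1 // /barrel_arc /= !eqxx ?orbT.
  + by exists (I 1, ordS (ordS i)); rewrite ?map1 ?bS // /barrel_arc /= !eqxx ?orbT.
  + by exists (I 3, ordS i); rewrite ?map3 // /barrel_arc /= !eqxx ?orbT.
rewrite (turn_adj (outer_turn F_full O _)) !inE => /or3P[]/eqP->.
- by exists (I 2, ordS i); rewrite ?map2 ?cS // /barrel_arc /= !eqxx ?orbT.
- exists (I 3, ordS (ordS i)); last by rewrite /barrel_arc /= !eqxx ?orbT.
  rewrite map3 uS; have [|-> _ _ _] := @outer_mod (ordS i).+1 i.+2.
    by apply: next_mod; rewrite /= modn_mod.
  by have [] := outer_pent F_full O (no_hex i.+1).
exists (I 3, i); last by rewrite /barrel_arc /= !eqxx ?orbT.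
by have [] := outer_pent F_full O (no_hex i).
Qed.

Lemma barrel_iso : graph_iso F (barrel n).
Proof.
have surj v : v \in codom barrel_map.
  have [j] : in_cap v.
    by apply: (@in_cap_outside set0); rewrite ?inE ?cards0 // => k hk; have := no_hex k; rewrite hk.
  pose i := Ordinal (ltn_pmod j n_gt0).
  have ij : i = j %[mod n] by rewrite /= modn_mod.
  have [uE _ _ _] := outer_mod ij.
  case=> ->; apply/codomP; [exists (I 0, i)|exists (I 1, i)|exists (I 2, i)|exists (I 3, i)].
  - by apply/eqP; rewrite (cap_aE O) ij.
  - by rewrite map1; apply/esym/b_mod.
  - by rewrite map2; apply/esym/c_mod.
  - by rewrite map3 uE.
exists (fun v => iinv (surj v)); split.
  exists barrel_map => [v|p]; first exact: f_iinv.
  by apply: barrel_map_inj; apply: f_iinv.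
move=> v w; have -> : adj v w = adj (barrel_map (iinv (surj v))) (barrel_map (iinv (surj w))).
  by rewrite !f_iinv.
move: (iinv _) (iinv _) => p q; rewrite /= /barrel_adj.
apply/andP/idP=> [[_ /orP[/barrel_map_arc//|/barrel_map_arc]]|pq].
  by rewrite adj_sym.
split; first by apply: contraTneq pq => ->; rewrite adj_irr.
by have [q' /barrel_map_inj <-] := barrel_map_nbr pq.
Qed.

End BarrelIso.

(** * One outer hexagon, or two consecutive ones, around a pentagonal cap *)

Section PentagonalCap.
Hypotheses (n5 : n = 5) (hex0 : hex 0) (pent2 : ~~ hex 2) (pent3 : ~~ hex 3) (pent4 : ~~ hex 4).

Let mod5 j : exists2 i, i < 5 & j = i %[mod n].
Proof. by exists (j %% 5); rewrite ?ltn_pmod // n5 modn_mod. Qed.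

Lemma hex_only k : hex k -> k = 0 %[mod n] \/ k = 1 %[mod n] /\ hex 1.
Proof.
have [i i5 ki] := mod5 k; have [_ _ _ ->] := outer_mod ki; rewrite ki.
move: i i5 {ki} => [|[|[|[|[|]]]]] // _ h; [by left|by right|..].
- by have := pent2; rewrite h.
- by have := pent3; rewrite h.
- by have := pent4; rewrite h.
Qed.

Lemma adj_hex_next0 j : adj (u j) (x 0) -> u j = u 0 \/ u j = u 1.
Proof.
have xu i : (x 0 == u i) = false by exact: (hex_outer_nextE n56 F_full O i hex0).
have [i i5 ji] := mod5 j; have [-> _ _ _] := outer_mod ji.
rewrite (turn_adj (outer_turn F_full O i)) !inE => /or3P[]/eqP E.
- by case: (hex_next_not_in_cap hex0); exists i; constructor 3.
- have [h|h] := boolP (hex i); last first.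
    by have [xi _] := outer_pent F_full O h; have := xu i.+1; rewrite E xi eqxx.
  have [ij|[ij _]] := hex_only h; have [-> _ _ _] := outer_mod ij; by [left|right].
have [k ik [[_ yk]|[h yk]]] := outer_prevE i.
  by have := xu k; rewrite E yk eqxx.
case: (hex_only h) => [k0|[k1 h1]].
  by right; have [-> _ _ _] := outer_mod (etrans ik (next_mod k0)).
have [_ xk _ _] := outer_mod k1; have [xy _] := outer_hexP F_full O hex0.
by have := outer_next_neq_prev F_full O 1; rewrite -xy E yk xk eqxx.
Qed.

Lemma turn_hex_next k : hex k -> turn (x k) (u k) (u k.+1) (r (x k) (u k.+1)).
Proof.
move=> hk; have [_ rk] := outer_hexP F_full O hk; apply: turnP rk => //.
by rewrite adj_sym; apply: adj_outer_next F_full O _.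
Qed.

(** Inside the cap only [u 0] and [u 1] can be adjacent to [x 0], and these are its two other
    neighbours. *)
Lemma third_next_not_in_cap : ~ in_cap (r (x 0) (u 1)).
Proof.
move=> tc; have T := turn_hex_next hex0.
have xt : adj (x 0) (r (x 0) (u 1)) by rewrite (turn_adj T) !inE eqxx !orbT.
have [j tE] := adj_hex_next hex0 tc (etrans (adj_sym _ _) xt).
have := turn_neq T; rewrite tE in xt *.
by case: (adj_hex_next0 (etrans (adj_sym _ _) xt)) => -> /=; rewrite !inE eqxx ?orbT /= ?andbF.
Qed.

(** Otherwise [x 0] would be the only exit from the cap and would separate it from the third
    neighbour of [x 0]. *)
Lemma hex1 : hex 1.
Proof.
apply: contraT => h1.
case: third_next_not_in_cap; apply: (@in_cap_outside [set x 0]).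
- by rewrite cards1.
- rewrite inE; apply/eqP=> E; case: (hex_next_not_in_cap hex0); rewrite -E.
  by exists 0; constructor 1.
- move=> k /hex_only[k0|[_]]; last by rewrite (negbTE h1).
  by rewrite inE; have [_ -> _ _] := outer_mod k0.
have := turn_neq (turn_hex_next hex0); rewrite inE eq_sym /= !inE.
by case/andP=> /norP[_ /norP[]].
Qed.

Lemma adjacent_hexagons_false : False.
Proof.
have h1 := hex1; have T0 := turn_hex_next hex0; have T1 := turn_hex_next h1.
(* Any other third neighbour of [x 0] would be separated from the cap by the pair [x 0], [x 1]. *)
have tE : r (x 0) (u 1) = x 1.
  apply/eqP; apply: contraT => tx1; case: third_next_not_in_cap.
  apply: (@in_cap_outside [set x 0; x 1]).
  - by rewrite cards2; case: (_ != _).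
  - rewrite !inE negb_or; apply/andP; split; apply/eqP=> E.
      by case: (hex_next_not_in_cap hex0); rewrite -E; exists 0; constructor 1.
    by case: (hex_next_not_in_cap h1); rewrite -E; exists 0; constructor 1.
  - by move=> k /hex_only[k0|[k1 _]]; rewrite !inE;
      [have [_ -> _ _] := outer_mod k0|have [_ -> _ _] := outer_mod k1]; rewrite eqxx ?orbT.
  have := turn_neq T0; rewrite !inE negb_or tx1 eq_sym /= !inE.
  by case/andP=> /norP[_ /norP[_ ->]].
have x10 : adj (x 1) (x 0).
  by rewrite adj_sym -tE (turn_adj T0) !inE eqxx !orbT.
have rx10 : r (x 1) (x 0) = u 1.
  rewrite -(turn31 T1); congr (r _ _).
  move: x10; rewrite (turn_adj T1) !inE !(hex_outer_nextE n56 F_full O _ hex0).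
  by move/eqP.
have [xy _] := outer_hexP F_full O hex0.
have ad : adj (u 1) (x 0) by rewrite xy; apply: adj_outer_prev F_full O _.
(* The edge between [x 0] and [x 1] closes a triangular face with [u 1]. *)
have /(short_face F_full (d := (u 1, x 0)) ad) : iter 3 fn (u 1, x 0) = (u 1, x 0).
  by rewrite /= /face_next /= tE rx10; congr (_, _); rewrite xy.
by move/(_ isT).
Qed.

End PentagonalCap.
End CapClosure.

(** * From the subgraph to a cap, and conclusion *)

Lemma cap_of_subgraph (F : plane_graph) n : n = 5 \/ n = 6 ->
  contains_subgraph F (del_vertices (barrel_end n)) -> exists a b c : nat -> F, cap n a b c.
Proof.
move=> n56 [f [f_inj f_adj]].
have n_gt0 : 0 < n by case: n56 => ->.
pose I i := Ordinal (ltn_pmod i n_gt0).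
have inner (k : 'I_3) i : (widen_ord (leqnSn 3) k, I i) \notin barrel_end n.
  by rewrite inE /= neq_ltn ltn_ord.
pose V (k : 'I_3) i : del_vertices (barrel_end n) :=
  exist (fun x => x \notin barrel_end n) _ (inner k i).
have VE k i l j : (f (V k i) == f (V l j)) = (k == l) && (i == j %[mod n]).
  by rewrite (inj_eq f_inj) -val_eqE /= xpair_eqE.
have V_adj k i l j : V k i != V l j -> barrel_arc (val (V k i)) (val (V l j)) ->
    adj (f (V k i)) (f (V l j)).
  by move=> ne arc; apply: f_adj; rewrite /= /del_adj /= /barrel_adj -val_eqE /= in ne *; rewrite ne arc.
have S i : I i.+1 = ordS (I i) by apply: val_inj; rewrite /= -addn1 -modnDml addn1.
exists (fun i => f (V (@Ordinal 3 0 isT) i)), (fun i => f (V (@Ordinal 3 1 isT) i)),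
  (fun i => f (V (@Ordinal 3 2 isT) i)); split=> [i|i|i|i|i j|i j|i j|i j|i j|i j]; rewrite ?VE //.
- apply: V_adj; last by rewrite /= S /barrel_arc /= !eqxx.
  by rewrite -(inj_eq f_inj) VE eqxx; case: n56 => ->; lia.
- by apply: V_adj; rewrite /barrel_arc /= ?eqxx ?orbT.
- by apply: V_adj; rewrite /barrel_arc /= ?eqxx ?orbT.
- rewrite adj_sym; apply: V_adj => //.
  by rewrite /= S /barrel_arc /= !eqxx ?orbT.
Qed.

Lemma oriented_cap_shift (F : plane_graph) n (a b c : nat -> F) k :
  oriented_cap n a b c -> oriented_cap n (shift a k) (shift b k) (shift c k).
Proof.
case=> C Oa Ob Oc; split=> [|i|i|i]; first exact: cap_shift.
- exact: Oa.
- exact: Ob.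
- exact: Oc.
Qed.

Lemma resonant_cap_iso (F : plane_graph) n (a b c : nat -> F) : n = 5 \/ n = 6 ->
  fullerene F -> oriented_cap n a b c -> k_resonant F 2 -> graph_iso F (barrel n).
Proof.
move=> n56 F_full O res.
suff no_hex k : ~~ outer_hex b c k by apply: barrel_iso O no_hex.
apply/negP=> hk; case: (n56) => nE; last first.
  exact: hexagonal_cap_outer_hex_not_resonant (oriented_cap_shift k O) nE hk res.
have apart j : outer_hex b c j -> ~~ outer_hex b c (j + 2).
  move=> hj; apply/negP=> hj2; rewrite addnC in hj2.
  exact: pentagonal_cap_outer_hexes_not_resonant n56 F_full (oriented_cap_shift j O) nE hj hj2 res.
have hmod i j : i = j %[mod 5] -> outer_hex b c i = outer_hex b c j.
  by move=> ij; have [] := outer_mod O (i := i) (j := j); rewrite ?nE.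
(* Modulo 5, [4 + j] precedes [j], so [j] is the first hexagon of its block; [apart] excludes
   [2 + j], and also [3 + j], which is at distance two before [j]. *)
have none j : outer_hex b c j -> ~~ outer_hex b c (4 + j) -> False.
  move=> hj h4; have h2 := apart j hj; rewrite addnC in h2.
  have h3 : ~~ outer_hex b c (3 + j).
    apply/negP=> h; have := apart _ h; rewrite (hmod _ j) ?hj //; lia.
  exact: (@adjacent_hexagons_false _ _ _ _ _ n56 F_full (oriented_cap_shift j O) nE hj h2 h3 h4).
(* If the predecessor of [k] is also hexagonal, the block starts there: [8 + k] is k - 2 modulo 5,
   excluded by [apart]. *)
have [h4|] := boolP (outer_hex b c (4 + k)); last exact: none.
apply: (none _ h4); apply/negP=> h8; have := apart _ h8.
by rewrite (hmod _ k) ?hk //; lia.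
Qed.

Theorem theorem3p4 (F : plane_graph) (hF : fullerene F)
    (hF20 : ~ graph_iso F F20) (hF24 : ~ graph_iso F F24)
    (hR : contains_subgraph F R5 \/ contains_subgraph F R6) :
  ~ k_resonant F 2.
Proof.
move=> res.
have iso n : n = 5 \/ n = 6 -> contains_subgraph F (del_vertices (barrel_end n)) ->
    graph_iso F (barrel n).
  move=> n56 /(cap_of_subgraph n56)[a [b [c]]] /(oriented_cap_exists n56 hF)[a' [b' [c' O]]].
  exact: resonant_cap_iso n56 hF O res.
by case: hR => sub; [apply/hF20/iso|apply/hF24/iso]; auto.
Qed.
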